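(* Let $(X,\mathrm{d}\mu)$ be a $\sigma$-finite measure space and let $Y_1,\dots,Y_d$ be measure spaces. Let $\theta_j>0$ with $\sum_{j=1}^d\theta_j=1$, and let $2\le r_j<\infty$ for $1\le j\le d$. Let $T_j:\mathcal{S}(Y_j)\to\mathcal{M}(X)$ be linear operators, each of which saturates $X$. Suppose that $$\int_X\prod_{j=1}^d|T_jf_j(x)|^{2\theta_j}\,\mathrm{d}\mu(x)\le B\prod_{j=1}^d\|f_j\|_{L^{r_j}(Y_j)}^{2\theta_j}$$ for all simple functions $f_j\in\mathcal{S}(Y_j)$, $1\le j\le d$. Then there exist nonnegative measurable functions $\phi_1,\dots,\phi_d$ on $X$ such that $$\prod_{j=1}^d\phi_j(x)^{\theta_j}\ge 1\quad\text{for a.e. } x\in X,$$ and such that for each $j$, $$\left(\int_X|T_jf_j(x)|^2\phi_j(x)\,\mathrm{d}\mu(x)\right)^{1/2}\le C B^{1/2}\|f_j\|_{L^{r_j}(Y_j)}\quad\text{for all } f_j\in\mathcal{S}(Y_j),$$ where $C$ is a finite constant depending only on $\{\theta_j,r_j\}_{j=1}^d$.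
   Context: $\mathcal{M}(X)$ is the class of measurable functions on $X$. $\mathcal{S}(Y_j)$ is the space of simple functions on $Y_j$ (with finite norm), equipped with the $L^{r_j}(Y_j)$-norm. A linear map $T:\mathcal{Y}\to\mathcal{M}(X)$ saturates $X$ if for each measurable $E\subseteq X$ of positive measure there exist a measurable $E'\subseteq E$ with $\mu(E')>0$ and an $h\in\mathcal{Y}$ such that $|Th|>0$ a.e. on $E'$. *)

(* Defs.v *)
From HB Require Import structures.
From mathcomp Require Import all_boot all_order all_algebra.
From mathcomp Require Import all_classical all_reals all_analysis.
From mathcomp Require Import complex.

Set Implicit Arguments.
Unset Strict Implicit.
Unset Printing Implicit Defensive.

Import Order.TTheory GRing.Theory Num.Theory.
Import numFieldNormedType.Exports.

Local Open Scope classical_set_scope.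
Local Open Scope ring_scope.

(* Functions are allowed to be either real- or complex-valued. *)
Variant scalar_kind := RealScalars | ComplexScalars.

Definition scalar_field (R : realType) (k : scalar_kind) : numFieldType :=
  match k with
  | RealScalars => (R : numFieldType)
  | ComplexScalars => (R[i] : numFieldType)
  end.

(* [Num.norm] on R[i] takes its values in R[i]; this is the absolute value as
   an element of R. *)
Definition modulus (R : realType) (k : scalar_kind) : scalar_field R k -> R :=
  match k return scalar_field R k -> R with
  | RealScalars => fun a : R => `|a|
  | ComplexScalars => fun a : R[i] => ComplexField.Normc.normc a
  end.

Section operators.
Context (R : realType) (k : scalar_kind).

Definition scalar_measurable d (T : measurableType d) :
    (T -> scalar_field R k) -> Prop :=
  match k return (T -> scalar_field R k) -> Prop with
  | RealScalars => fun (f : T -> R) => measurable_fun setT f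
  | ComplexScalars => fun (f : T -> R[i]) =>
      measurable_fun setT (fun x => complex.Re (f x)) /\
      measurable_fun setT (fun x => complex.Im (f x))
  end.

Definition scalar_Lnorm d (Y : measurableType d)
    (nu : {measure set Y -> \bar R}) (r : R) (f : Y -> scalar_field R k) : \bar R :=
  ('N[nu]_(r%:E)[EFin \o (@modulus R k \o f)])%E.

Definition simple_space d (Y : measurableType d)
    (nu : {measure set Y -> \bar R}) (r : R) : set (Y -> scalar_field R k) :=
  [set f | [/\ scalar_measurable f, finite_set (range f)
             & (scalar_Lnorm nu r f < +oo)%E]].

(* An operator is given by the values of a function on a subspace S of the
   functions on Y; what it does outside S is irrelevant. Its values are
   measurable functions taken up to a.e. equality, so linearity is only
   required almost everywhere. *)
Definition linear_operator dX (X : measurableType dX)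
    (mu : {measure set X -> \bar R}) (Y : Type) (S : set (Y -> scalar_field R k))
    (T : (Y -> scalar_field R k) -> (X -> scalar_field R k)) : Prop :=
  (forall f, S f -> scalar_measurable (T f)) /\
  (forall (a : scalar_field R k) f g, S f -> S g ->
     {ae mu, forall x, T (fun y => a * f y + g y) x = a * T f x + T g x}).

Definition saturates dX (X : measurableType dX)
    (mu : {measure set X -> \bar R}) (Y : Type) (S : set (Y -> scalar_field R k))
    (T : (Y -> scalar_field R k) -> (X -> scalar_field R k)) : Prop :=
  forall E : set X, measurable E -> (0 < mu E)%E ->
  exists E' : set X, [/\ measurable E', E' `<=` E, (0 < mu E')%E
    & exists2 h, S h & {ae mu, forall x, E' x -> 0 < modulus (T h x)}].

End operators.

(* Main.v *)
Require Import Defs.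
From HB Require Import structures.
From mathcomp Require Import all_boot all_order all_algebra.
From mathcomp Require Import all_classical all_reals all_analysis.
From mathcomp Require Import complex measurable_realfun.
From mathcomp Require Import ring lra.

Set Implicit Arguments.
Unset Strict Implicit.
Unset Printing Implicit Defensive.

Import Order.TTheory GRing.Theory Num.Theory.
Import numFieldNormedType.Exports.

Local Open Scope classical_set_scope.
Local Open Scope ring_scope.

(** The theorem is a duality statement.  Let [G j] be the set of the convex
    combinations of the functions |T_j f|^2 with f in the unit ball.

    Passing from squares to their convex combinations costs only a constant
    ([square_hull_bound]).  The multilinear inequality is applied to random
    signed combinations of the functions, with independent signs for each j.
    Khintchine's inequality bounds the square functions below the means of
    |T_j (sum of +- f_i)|^(2 theta_j); in the other direction, and since
    r_j >= 2, it bounds the L^(r_j) norms of the signed combinations by the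
    square sums of the norms.  Hence the integral of the weighted geometric
    mean of g_1, ..., g_d is at most a constant A for all g_j in [G j].

    Suppose that this concave functional were maximal at (g_1, ..., g_d), and
    let H be the product of the g_j^(theta_j).  Moving g_j towards f in [G j],
    the first-order condition says that the integral of f H / g_j is at most
    that of H, hence at most A; and the weights phi_j = H / g_j satisfy
    prod_j phi_j^(theta_j) = 1 where H > 0.  A maximum need not exist, because
    mass can concentrate.  But if f is required to be at most a multiple m S_j of a
    fixed member S_j of [G j], a near-maximiser of the mean of the
    (g_j + S_j) / 2 is enough, at the price of a constant
    ([exists_local_weights]).

    For each choice of the S_j and of m, the weights with these properties
    form a convex set, and these sets are directed downwards.  By a Komlos
    type compactness argument ([directed_komlos]) they share a limit in the
    sense of almost everywhere convergence.  Fatou's lemma carries the integral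
    bounds over to the limit; saturation makes the limit finite almost
    everywhere and the product of its powers at least 1
    ([disentanglement]). *)

(** * Elementary inequalities for powers *)

Section power_inequalities.
Context (R : realType).
Implicit Types (x y t p : R).

Lemma powR_le_tangent t x : 0 <= t <= 1 -> 0 <= x -> x `^ t <= 1 + t * (x - 1).
Proof.
move=> /andP[t0 t1] x0; have [->|xn0] := eqVneq x 0.
  have [->|tn0] := eqVneq t 0; first by rewrite powRr0; lra.
  by rewrite powR0//; lra.
have xgt0 : 0 < x by rewrite lt_neqAle eq_sym xn0.
have [->|tn0] := eqVneq t 0; first by rewrite powRr0; lra.
have [->|tn1] := eqVneq t 1; first by rewrite powRr1//; lra.
have tgt0 : 0 < t by rewrite lt_neqAle eq_sym tn0.
have tlt1 : t < 1 by rewrite lt_neqAle tn1.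
have := @conjugate_powR R (x `^ t) 1 t^-1 (1 - t)^-1 (powR_ge0 _ _) ler01.
rewrite !invr_gt0 tgt0 subr_gt0 tlt1 !invrK mulr1 powR1 -powRrM divff// powRr1//.
move=> /(_ isT isT); lra.
Qed.

Lemma powR_ge_tangent p x : 1 <= p -> 0 <= x -> 1 + p * (x - 1) <= x `^ p.
Proof.
move=> p1 x0.
have p0 : 0 < p by lra.
have [neg|pos] := ltP (1 + p * (x - 1)) 0.
  by apply: (le_trans (ltW neg)); exact: powR_ge0.
have pV : 0 <= p^-1 <= 1 by rewrite invr_ge0 (ltW p0) invf_le1.
have := powR_le_tangent pV pos.
have -> : 1 + p^-1 * (1 + p * (x - 1) - 1) = x by field; lra.
move=> h.
have := ge0_ler_powR (ltW p0) _ _ h; rewrite !nnegrE powR_ge0 => /(_ isT x0).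
by rewrite -powRrM mulVf ?gt_eqF// powRr1.
Qed.

(** Averaging the tangent bound of the convex power at the mean y. *)
Lemma powR_jensen p N (c x : 'I_N -> R) : 1 <= p ->
  (forall i, 0 <= c i) -> \sum_i c i = 1 -> (forall i, 0 <= x i) ->
  (\sum_i c i * x i) `^ p <= \sum_i c i * x i `^ p.
Proof.
move=> p1 c0 c1 x0; set y := \sum_i c i * x i.
have y0 : 0 <= y by apply: sumr_ge0 => i _; rewrite mulr_ge0.
have [yE|yn0] := eqVneq y 0.
  rewrite yE powR0; last by lra.
  by apply: sumr_ge0 => i _; rewrite mulr_ge0// powR_ge0.
have ygt0 : 0 < y by rewrite lt_neqAle eq_sym yn0.
have tang i : c i * (y `^ p * (1 + p * (x i / y - 1))) <= c i * x i `^ p.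
  apply: ler_wpM2l => //.
  have -> : x i `^ p = y `^ p * (x i / y) `^ p.
    by rewrite -powRM ?divr_ge0// mulrCA divff// mulr1.
  by rewrite ler_wpM2l ?powR_ge0// powR_ge_tangent ?divr_ge0.
apply: le_trans (ler_sum _ (fun i _ => tang i)).
rewrite [leRHS](_ : _ = y `^ p); first by [].
transitivity (y `^ p * ((1 - p) * \sum_i c i + p / y * \sum_i c i * x i)).
  rewrite !mulr_sumr -big_split/= mulr_sumr; apply: eq_bigr => i _; field.
  by [].
by rewrite -/y c1 -mulrA mulVf//; ring.
Qed.

Lemma powR_add_le p x y : 0 <= p -> 0 <= x -> 0 <= y ->
  (x + y) `^ p <= 2 `^ p * (x `^ p + y `^ p).
Proof.
move=> p0; wlog xy : x y / x <= y.
  by move=> h x0 y0; case: (leP x y) => [|/ltW] xy; [|rewrite addrC (addrC (x `^ p))]; exact: h.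
move=> x0 y0; apply: (@le_trans _ _ ((2 * y) `^ p)).
  by apply: ge0_ler_powR => //; rewrite ?nnegrE; lra.
by rewrite powRM// ler_wpM2l ?powR_ge0// lerDr powR_ge0.
Qed.

(** For x >= 1, from exp x = (exp (x / N))^N and exp (x / N) >= x / N. *)
Lemma powR_le_exp p x N : 0 <= p <= N%:R -> 0 <= x ->
  x `^ p <= N%:R ^+ N * expR x.
Proof.
move=> /andP[p0 pN] x0.
case: N pN => [|N] pN.
  have -> : p = 0 by apply/le_anti; rewrite pN p0.
  by rewrite powRr0 expr0 mul1r -expR0 ler_expR.
have N1 : 1 <= N.+1%:R :> R by rewrite ler1n.
have [x1|x1] := leP x 1.
  apply: (@le_trans _ _ 1).
    have : x `^ p <= 1 `^ p by apply: ge0_ler_powR => //; rewrite nnegrE.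
    by rewrite powR1.
  rewrite -[leLHS]mul1r; apply: ler_pM => //; first by rewrite exprn_ege1.
  by rewrite -expR0 ler_expR.
apply: (@le_trans _ _ (x `^ N.+1%:R)); first by apply: ler_powR => //; exact: ltW.
rewrite powR_mulrn//.
have -> : expR x = expR (x / N.+1%:R) ^+ N.+1.
  by rewrite -expRM_natr divfK// gt_eqF//; lra.
rewrite -exprMn; apply: lerXn2r; rewrite ?nnegrE//.
rewrite mulrC -ler_pdivrMr//.
by apply: le_trans (expR_ge1Dx _); rewrite lerDr.
Qed.

(** Comparison with the geometric series: exp y <= 1 / (1 - y), and the mean of
    1 / (1 - x) and 1 / (1 + x) is 1 / (1 - x^2). *)
Lemma cosh_le x : `|x| <= 2^-1 -> (expR x + expR (- x)) / 2 <= expR (2 * x ^+ 2).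
Proof.
move=> xh; have /andP[x1 x2] : - 2^-1 <= x <= 2^-1 by rewrite -ler_norml.
have h y : - 2^-1 <= y <= 2^-1 -> expR y <= (1 - y)^-1.
  move=> /andP[y1 y2]; rewrite -[y in leLHS]opprK expRN lef_pV2 ?posrE ?expR_gt0//; last by lra.
  by have := expR_ge1Dx (- y).
have ha : expR x <= (1 - x)^-1 by apply: h; lra.
have hb : expR (- x) <= (1 - - x)^-1 by apply: h; lra.
apply: le_trans (expR_ge1Dx _).
apply: (@le_trans _ _ (((1 - x)^-1 + (1 + x)^-1) / 2)).
  by rewrite opprK in hb; lra.
have -> : ((1 - x)^-1 + (1 + x)^-1) / 2 = (1 - x ^+ 2)^-1.
  by field; rewrite ?andbT; repeat (apply/andP; split); apply/eqP; nra.
have xx : x ^+ 2 <= 4^-1 by nra.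
have x0 : 0 <= x ^+ 2 by exact: sqr_ge0.
rewrite -[leLHS]mul1r ler_pdivrMr; last by lra.
by nra.
Qed.

End power_inequalities.

(** * Khintchine's inequality for random signs *)

Section random_signs.
Context (R : realType).

Definition sign_sum N (a : 'I_N -> R) (e : {ffun 'I_N -> bool}) : R :=
  \sum_i (-1) ^+ e i * a i.

Definition sign_mean N (F : {ffun 'I_N -> bool} -> R) : R :=
  2 ^- N * \sum_e F e.

Lemma sign_mean_le N (F G : {ffun 'I_N -> bool} -> R) :
  (forall e, F e <= G e) -> sign_mean F <= sign_mean G.
Proof.
move=> FG; rewrite ler_wpM2l ?invr_ge0 ?exprn_ge0//.
by apply: ler_sum => e _; exact: FG.
Qed.

Lemma sign_meanD N (F G : {ffun 'I_N -> bool} -> R) :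
  sign_mean (fun e => F e + G e) = sign_mean F + sign_mean G.
Proof. by rewrite /sign_mean big_split/= mulrDr. Qed.

Lemma sign_meanZ N k (F : {ffun 'I_N -> bool} -> R) :
  sign_mean (fun e => k * F e) = k * sign_mean F.
Proof. by rewrite /sign_mean -mulr_sumr mulrCA. Qed.

Lemma sign_mean_cst N k : sign_mean (fun _ : {ffun 'I_N -> bool} => k) = k.
Proof.
rewrite /sign_mean sumr_const card_ffun card_bool card_ord -[k *+ _]mulr_natl natrX.
by rewrite mulrA mulVf ?mul1r// expf_neq0.
Qed.

Lemma sign_sumZ N k (a : 'I_N -> R) e :
  sign_sum (fun i => k * a i) e = k * sign_sum a e.
Proof. by rewrite mulr_sumr; apply: eq_bigr => i _; rewrite mulrCA. Qed.

(** Independence of the signs turns the mean of the product into a product of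
    means. *)
Lemma sign_mean_expR N (a : 'I_N -> R) :
  sign_mean (fun e => expR (sign_sum a e)) = \prod_i ((expR (a i) + expR (- a i)) / 2).
Proof.
rewrite /sign_mean (eq_bigr (fun e : {ffun 'I_N -> bool} =>
  \prod_i expR ((-1) ^+ e i * a i))) => [|e _]; last by rewrite /sign_sum expR_sum.
rewrite -(bigA_distr_bigA (fun i (b : bool) => expR ((-1) ^+ b * a i))).
rewrite big_split/= prodr_const card_ord exprVn mulrC; congr (_ * _).
apply: eq_bigr => i _; rewrite big_bool /= expr1 expr0 mul1r mulN1r addrC.
by [].
Qed.

(** Distinct signs are orthogonal. *)
Lemma sign_mean_sqr N (a : 'I_N -> R) :
  sign_mean (fun e => sign_sum a e ^+ 2) = \sum_i a i ^+ 2.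
Proof.
have cov i k : \sum_(e : {ffun 'I_N -> bool}) (-1) ^+ e i * (-1) ^+ e k =
    2 ^+ N *+ (i == k) :> R.
  have [->|ik] := eqVneq i k.
    under eq_bigr do rewrite -expr2 sqrr_sign.
    by rewrite sumr_const card_ffun card_bool card_ord natrX.
  (* flipping the i-th sign is an involution that negates the summand *)
  pose flip (e : {ffun 'I_N -> bool}) := [ffun j => if j == i then ~~ e j else e j].
  have flipK : involutive flip.
    by move=> e; apply/ffunP => j; rewrite !ffunE; case: eqP => //; rewrite negbK.
  set s := LHS; suff : s = - s by move=> /eqP; rewrite -addr_eq0 -mulr2n mulrn_eq0 => /eqP.
  rewrite {1}/s (reindex_inj (inv_inj flipK))/= -sumrN; apply: eq_bigr => e _.
  by rewrite !ffunE eqxx eq_sym (negbTE ik) signrN mulNr.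
rewrite /sign_mean.
under eq_bigr => e _.
  rewrite expr2 {1}/sign_sum mulr_suml; under eq_bigr do rewrite mulr_sumr.
  over.
rewrite exchange_big/= mulr_sumr; apply: eq_bigr => i _.
rewrite exchange_big/= (bigD1 i)//= [X in _ + X]big1 ?addr0 => [|k ki].
  under eq_bigr do rewrite /= mulrACA.
  by rewrite -mulr_suml cov eqxx mulr1n mulrA mulVf ?expf_neq0// mul1r.
under eq_bigr do rewrite /= mulrACA.
by rewrite -mulr_suml cov eq_sym (negbTE ki) mulr0n mul0r.
Qed.

(** The hypothesis forces every |a i| into the range of [cosh_le]. *)
Lemma sign_mean_expR_le N (a : 'I_N -> R) : \sum_i a i ^+ 2 <= 4^-1 ->
  sign_mean (fun e => expR (sign_sum a e)) <= expR 1.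
Proof.
move=> ha; rewrite sign_mean_expR.
have hi i : `|a i| <= 2^-1.
  rewrite -(@ler_pXn2r _ 2)//; rewrite ?nnegrE// real_normK ?num_real//.
  rewrite exprVn -natrX; apply: le_trans ha.
  by rewrite (bigD1 i)//= lerDl; apply: sumr_ge0 => k _; exact: sqr_ge0.
apply: (@le_trans _ _ (\prod_i expR (2 * a i ^+ 2))).
  apply: ler_prod => i _; rewrite cosh_le ?hi// andbT divr_ge0//.
by rewrite -expR_sum ler_expR -mulr_sumr; lra.
Qed.

(** The modulus of the random sum of the complex numbers a i + i b i. *)
Definition sign_norm N (a b : 'I_N -> R) (e : {ffun 'I_N -> bool}) : R :=
  Num.sqrt (sign_sum a e ^+ 2 + sign_sum b e ^+ 2).

Lemma sign_norm_ge0 N (a b : 'I_N -> R) e : 0 <= sign_norm a b e.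
Proof. exact: sqrtr_ge0. Qed.

Lemma sign_normZ N k (a b : 'I_N -> R) e : 0 <= k ->
  sign_norm (fun i => k * a i) (fun i => k * b i) e = k * sign_norm a b e.
Proof.
move=> k0; rewrite /sign_norm !sign_sumZ !exprMn -mulrDr sqrtrM ?sqr_ge0//.
by rewrite sqrtr_sqr ger0_norm.
Qed.

Lemma sign_norm_sqr_mean N (a b : 'I_N -> R) :
  sign_mean (fun e => sign_norm a b e ^+ 2) = \sum_i (a i ^+ 2 + b i ^+ 2).
Proof.
rewrite big_split/= -!sign_mean_sqr -sign_meanD.
by congr sign_mean; apply/funext => e; rewrite sqr_sqrtr// addr_ge0 ?sqr_ge0.
Qed.

(** Exponential moments dominate all power moments: for z = s + i t, the power
    |z|^p is at most a constant times exp (|s| + |t|), and this is at most the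
    sum of the exponentials of +- 2 s and +- 2 t. *)
Lemma khintchine_normalised (p : R) n N (a b : 'I_N -> R) : 0 <= p <= n%:R ->
  \sum_i (a i ^+ 2 + b i ^+ 2) <= 16^-1 ->
  sign_mean (fun e => sign_norm a b e `^ p) <= n%:R ^+ n * (4 * expR 1).
Proof.
move=> pn hab.
have ha0 : 0 <= \sum_i a i ^+ 2 by apply: sumr_ge0 => i _; exact: sqr_ge0.
have hb0 : 0 <= \sum_i b i ^+ 2 by apply: sumr_ge0 => i _; exact: sqr_ge0.
rewrite big_split/= in hab.
pose F k (c : 'I_N -> R) := fun e => expR (sign_sum (fun i => k * c i) e).
have hF k c : k ^+ 2 = 4 -> \sum_i c i ^+ 2 <= 16^-1 -> sign_mean (F k c) <= expR 1.
  move=> k2 hc; apply: sign_mean_expR_le.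
  by under eq_bigr do rewrite exprMn k2; rewrite -mulr_sumr; lra.
apply: (@le_trans _ _ (sign_mean (fun e => n%:R ^+ n *
    ((F 2 a e + F (-2) a e) + (F 2 b e + F (-2) b e))))); last first.
  rewrite sign_meanZ !sign_meanD ler_wpM2l ?exprn_ge0//.
  have := hF 2 a; have := hF (-2) a; have := hF 2 b; have := hF (-2) b.
  rewrite sqrrN -natrX => /(_ erefl) h1 /(_ erefl) h2 /(_ erefl) h3 /(_ erefl) h4.
  have {}h1 := h1 ltac:(lra); have {}h2 := h2 ltac:(lra).
  have {}h3 := h3 ltac:(lra); have {}h4 := h4 ltac:(lra).
  lra.
apply: sign_mean_le => e.
apply: le_trans (powR_le_exp pn (sign_norm_ge0 _ _ _)) _.
rewrite ler_wpM2l ?exprn_ge0//.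
rewrite /F !sign_sumZ /sign_norm; set s := sign_sum a e; set t := sign_sum b e.
have abs_exp (y : R) : expR (2 * `|y|) <= expR (2 * y) + expR (-2 * y).
  have := expR_ge0 (2 * y); have := expR_ge0 (-2 * y).
  by case: (ler0P y) => y0; rewrite ?mulrN ?mulNr => h1 h2; lra.
have st : Num.sqrt (s ^+ 2 + t ^+ 2) <= `|s| + `|t|.
  rewrite -[leRHS]ger0_norm ?addr_ge0// -sqrtr_sqr ler_wsqrtr//.
  rewrite sqrrD !real_normK ?num_real// addrAC lerDl.
  by rewrite mulrn_wge0// mulr_ge0.
apply: (@le_trans _ _ (expR (`|s| + `|t|))); first by rewrite ler_expR.
apply: (@le_trans _ _ (expR (2 * `|s|) + expR (2 * `|t|))); last by apply: lerD; exact: abs_exp.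
have := expR_ge0 (2 * `|s|); have := expR_ge0 (2 * `|t|).
have [h|h] := leP `|s| `|t|.
  have : expR (`|s| + `|t|) <= expR (2 * `|t|) by rewrite ler_expR; lra.
  lra.
have : expR (`|s| + `|t|) <= expR (2 * `|s|) by rewrite ler_expR; lra.
lra.
Qed.

(** Homogeneity reduces the claim to the normalised case; dividing by 4 s brings
    the square sum to 1/16. *)
Lemma khintchine_upper (p : R) : 0 <= p -> exists2 K : R, 1 <= K &
  forall N (a b : 'I_N -> R), sign_mean (fun e => sign_norm a b e `^ p) <=
    K * Num.sqrt (\sum_i (a i ^+ 2 + b i ^+ 2)) `^ p.
Proof.
move=> p0; have [n pn] : exists n : nat, p <= n.+1%:R.
  by exists (Num.truncn p); exact/ltW/truncnS_gt.
have pn' : 0 <= p <= n.+1%:R by rewrite p0.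
exists (4 `^ p * (n.+1%:R ^+ n.+1 * (4 * expR 1))).
  rewrite -[leLHS]mul1r; apply: ler_pM => //.
    have : 4 `^ 0 <= 4 `^ p by apply: ler_powR => //; rewrite ler1n.
    by rewrite powRr0.
  rewrite -[leLHS]mul1r; apply: ler_pM => //; first by rewrite exprn_ege1// ler1n.
  by have := expR_ge1Dx (1 : R); lra.
move=> N a b; set s2 := \sum_i _; set s := Num.sqrt s2.
have s20 : 0 <= s2 by apply: sumr_ge0 => i _; rewrite addr_ge0 ?sqr_ge0.
have s0 : 0 <= s by exact: sqrtr_ge0.
have sE : s ^+ 2 = s2 by rewrite sqr_sqrtr.
have [sz|snz] := eqVneq s 0.
  have z i : a i = 0 /\ b i = 0.
    have : a i ^+ 2 + b i ^+ 2 = 0.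
      apply/eqP; move: sE; rewrite sz expr0n/= => /esym/eqP.
      rewrite psumr_eq0 => [/allP/(_ i)|k _]; last by rewrite addr_ge0 ?sqr_ge0.
      by rewrite mem_index_enum => /(_ isT) /eqP ->.
    move=> /eqP; rewrite paddr_eq0 ?sqr_ge0// !sqrf_eq0 => /andP[/eqP ? /eqP ?].
    by [].
  have -> : sign_norm a b = fun=> 0.
    apply/funext => e; rewrite /sign_norm /sign_sum.
    rewrite [X in X ^+ 2 + _]big1 => [|i _]; last by rewrite (z i).1 mulr0.
    rewrite [X in _ + X ^+ 2]big1 => [|i _]; last by rewrite (z i).2 mulr0.
    by rewrite expr0n addr0 sqrtr0.
  rewrite sign_mean_cst sz.
  have [->|pz] := eqVneq p 0; last by rewrite powR0// mulr0.
  rewrite !powRr0 mulr1 mul1r -[leLHS]mul1r; apply: ler_pM => //.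
    by rewrite exprn_ege1// ler1n.
  by have := expR_ge1Dx (1 : R); lra.
have sgt0 : 0 < s by rewrite lt_neqAle eq_sym snz.
pose k := (4 * s)^-1.
have k0 : 0 < k by rewrite invr_gt0; lra.
have scale e : sign_norm a b e `^ p =
    (4 * s) `^ p * sign_norm (fun i => k * a i) (fun i => k * b i) e `^ p.
  rewrite sign_normZ ?(ltW k0)// -powRM ?mulr_ge0 ?sign_norm_ge0 ?(ltW k0)//.
  by rewrite mulrA mulfV ?mul1r// mulf_neq0.
under [X in sign_mean X]funext => e do rewrite scale.
rewrite sign_meanZ powRM//.
rewrite [leRHS](_ : _ = 4 `^ p * s `^ p * (n.+1%:R ^+ n.+1 * (4 * expR 1))); last by ring.
apply: ler_wpM2l; first by rewrite mulr_ge0 ?powR_ge0.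
apply: khintchine_normalised => //.
under eq_bigr do rewrite !exprMn -mulrDr.
rewrite -mulr_sumr -/s2 -sE -exprMn.
have -> : k * s = 4^-1 by rewrite /k invfM mulfVK.
by rewrite exprVn -natrX.
Qed.

(** Interpolating the second moment between the p-th and the fourth one: a
    number t that is at most lambda has t^2 <= lambda^(2-p) t^p, any other has
    t^2 <= t^4/lambda^2. *)
Lemma sqr_le_interpolation (p t lam : R) : 0 <= p <= 2 -> 0 <= t -> 0 < lam ->
  t ^+ 2 <= lam `^ (2 - p) * t `^ p + t `^ 4 / lam ^+ 2.
Proof.
move=> /andP[p0 p2] t0 lam0; have [tl|lt] := leP t lam.
  apply: (@le_trans _ _ (lam `^ (2 - p) * t `^ p)); last first.
    by rewrite lerDl divr_ge0 ?powR_ge0 ?sqr_ge0.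
  rewrite -powR_mulrn//; have -> : t `^ 2 = t `^ (2 - p) * t `^ p.
    by rewrite -powRD ?subrK// pnatr_eq0.
  rewrite ler_wpM2r ?powR_ge0//; apply: ge0_ler_powR; rewrite ?nnegrE ?(ltW lam0)//.
  by rewrite subr_ge0.
apply: (@le_trans _ _ (t `^ 4 / lam ^+ 2)); last first.
  by rewrite lerDr mulr_ge0 ?powR_ge0.
rewrite (powR_mulrn 4)// ler_pdivlMr ?exprn_gt0//.
rewrite (exprM t 2 2) [leRHS]expr2 ler_wpM2l ?sqr_ge0//.
by apply: lerXn2r; rewrite ?nnegrE ?(ltW lam0) ?(ltW lt).
Qed.

(** The second moment is the square sum s^2, and the fourth one is at most
    K s^4.  Interpolating at a height lam with lam^2 = 2 K s^2 absorbs the fourth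
    moment into half of the second one. *)
Lemma khintchine_lower : exists2 L : R, 1 <= L &
  forall (p : R) N (a b : 'I_N -> R), 0 < p <= 2 ->
    Num.sqrt (\sum_i (a i ^+ 2 + b i ^+ 2)) `^ p <=
    L * sign_mean (fun e => sign_norm a b e `^ p).
Proof.
have [K K1 hK] := @khintchine_upper 4 ltac:(by []).
exists (4 * K); first by lra.
move=> p N a b /andP[p0 p2]; set s2 := \sum_i _; set s := Num.sqrt s2.
have s20 : 0 <= s2 by apply: sumr_ge0 => i _; rewrite addr_ge0 ?sqr_ge0.
have s0 : 0 <= s by exact: sqrtr_ge0.
have sE : s ^+ 2 = s2 by rewrite sqr_sqrtr.
have M0 : 0 <= sign_mean (fun e => sign_norm a b e `^ p).
  by rewrite mulr_ge0 ?invr_ge0 ?exprn_ge0// sumr_ge0// => e _; exact: powR_ge0.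
have [sz|snz] := eqVneq s 0.
  by rewrite sz powR0 ?gt_eqF// mulr_ge0//; lra.
have sgt0 : 0 < s by rewrite lt_neqAle eq_sym snz.
pose kap := Num.sqrt (2 * K).
have kap2 : kap ^+ 2 = 2 * K by rewrite sqr_sqrtr//; lra.
have kap1 : 1 <= kap by rewrite -sqrtr1 ler_wsqrtr//; lra.
set M := sign_mean _ in M0 *.
have step : s2 <= (kap * s) `^ (2 - p) * M + s2 / 2.
  rewrite -[leLHS](sign_norm_sqr_mean a b).
  apply: (@le_trans _ _ (sign_mean (fun e => (kap * s) `^ (2 - p) * sign_norm a b e `^ p +
      (kap * s) ^- 2 * sign_norm a b e `^ 4))).
    apply: sign_mean_le => e; rewrite [(kap * s) ^- 2 * _]mulrC.
    apply: sqr_le_interpolation; rewrite ?sign_norm_ge0 ?(ltW p0)//.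
    by rewrite mulr_gt0//; lra.
  rewrite sign_meanD !sign_meanZ lerD2l.
  apply: (@le_trans _ _ ((kap * s) ^- 2 * (K * s `^ 4))).
    by rewrite ler_wpM2l ?hK// invr_ge0 sqr_ge0.
  rewrite (powR_mulrn 4)// exprMn kap2 -sE le_eqVlt; apply/orP; left; apply/eqP.
  by field; rewrite snz/=; lra.
have split2 : s2 = s `^ p * s `^ (2 - p).
  by rewrite -powRD ?(addrC p) ?subrK ?pnatr_eq0// powR_mulrn.
have kp : kap `^ (2 - p) <= 2 * K.
  by rewrite -kap2 -powR_mulrn; [apply: ler_powR => //; lra|lra].
have sp : 0 < s `^ (2 - p) by exact: powR_gt0.
rewrite powRM// in step; last by lra.
rewrite -(ler_pM2r sp) -split2.
have : kap `^ (2 - p) * s `^ (2 - p) * M <= (2 * K) * s `^ (2 - p) * M.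
  by rewrite ler_wpM2r// ler_wpM2r// ltW.
lra.
Qed.

End random_signs.

(** * A level for directed families of sets *)

Section sup_inf.
Context (R : realType).

(** The level m is the supremum over i of the infimum of E on D i.  On a set D i
    whose infimum is close to m, all near-minimisers at level m can be compared,
    whichever smaller set they are taken from. *)
Lemma sup_inf_level (I P : Type) (D : I -> set P) (E : P -> R) (M : R) (i0 : I) :
  (forall i, D i !=set0) -> (forall i p, D i p -> 0 <= E p <= M) ->
  exists m : R,
    (forall eps, 0 < eps -> exists i, forall p, D i p -> m - eps < E p) /\
    (forall eps i, 0 < eps -> exists2 p, D i p & E p < m + eps).
Proof.
move=> D0 EM.
have hinf i : has_inf (E @` D i).
  split; first by have [p Dp] := D0 i; exists (E p), p.
  by exists 0 => _ [p Dp <-]; have /andP[] := EM _ _ Dp.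
pose v i := inf (E @` D i).
have vE i p : D i p -> v i <= E p.
  by move=> Dp; apply: ge_inf; [exact: (hinf i).2|exists p].
have hsup : has_sup (range v).
  split; first by exists (v i0), i0.
  exists M => _ [i _ <-]; have [p Dp] := D0 i.
  by apply: le_trans (vE _ _ Dp) _; have /andP[] := EM _ _ Dp.
exists (sup (range v)); split=> [eps eps0|eps i eps0].
  have [_ [i _ <-] vi] := sup_adherent eps0 hsup.
  by exists i => p Dp; apply: lt_le_trans vi (vE _ _ Dp).
have [_ [p Dp <-] Ep] := inf_adherent eps0 (hinf i).
exists p => //; apply: lt_le_trans Ep _; rewrite lerD2r.
by apply: ub_le_sup; [exact: hsup.2|exists i].
Qed.

End sup_inf.

(** * Integrals of nonnegative real functions *)

Section nonneg_integrals.
Context d (X : measurableType d) (R : realType) (mu : {measure set X -> \bar R}).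
Implicit Types f g : X -> R.

Lemma integralR_le f g : (forall x, 0 <= f x) -> measurable_fun setT f ->
  measurable_fun setT g -> (forall x, f x <= g x) ->
  (\int[mu]_x (f x)%:E <= \int[mu]_x (g x)%:E)%E.
Proof.
move=> f0 mf mg fg; apply: ge0_le_integral => //.
- by move=> x _; rewrite lee_fin.
- exact/measurable_EFinP.
- exact/measurable_EFinP.
- by move=> x _; rewrite lee_fin.
Qed.

Lemma integralRD f g : (forall x, 0 <= f x) -> (forall x, 0 <= g x) ->
  measurable_fun setT f -> measurable_fun setT g ->
  (\int[mu]_x (f x + g x)%:E = \int[mu]_x (f x)%:E + \int[mu]_x (g x)%:E)%E.
Proof.
move=> f0 g0 mf mg; rewrite -ge0_integralD//.
- by move=> x _; rewrite lee_fin.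
- exact/measurable_EFinP.
- by move=> x _; rewrite lee_fin.
- exact/measurable_EFinP.
Qed.

Lemma integralRZ k f : 0 <= k -> (forall x, 0 <= f x) -> measurable_fun setT f ->
  (\int[mu]_x (k * f x)%:E = k%:E * \int[mu]_x (f x)%:E)%E.
Proof.
move=> k0 f0 mf; rewrite -ge0_integralZl_EFin//.
- by move=> x _; rewrite lee_fin.
- exact/measurable_EFinP.
Qed.

Lemma integralR_sum (I : Type) (s : seq I) (f : I -> X -> R) :
  (forall i x, 0 <= f i x) -> (forall i, measurable_fun setT (f i)) ->
  (\int[mu]_x (\sum_(i <- s) f i x)%:E = \sum_(i <- s) \int[mu]_x (f i x)%:E)%E.
Proof.
move=> f0 mf; rewrite -ge0_integral_sum//.
- by apply: eq_integral => x _; rewrite sumEFin.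
- by move=> i; exact/measurable_EFinP.
- by move=> i x _; rewrite lee_fin.
Qed.

Lemma measurable_invr_ge0 f : (forall x, 0 <= f x) -> measurable_fun setT f ->
  measurable_fun setT (fun x => (f x)^-1).
Proof.
move=> f0 mf; rewrite (_ : (fun _ => _) = (fun y : R => y `^ (-1)) \o f).
  by apply: measurableT_comp => //; exact: measurable_powR.
by apply/funext => x /=; rewrite powR_inv1.
Qed.

End nonneg_integrals.

(** * Komlos-type compactness for directed families of convex sets *)

Lemma nneseries_le_half (R : realType) (u : nat -> \bar R) (C : R) : 0 <= C ->
  (forall n, 0 <= u n)%E -> (forall n, (u n <= (C * (2 ^+ n)^-1)%:E)%E) ->
  (\sum_(n <oo) u n <= (2 * C)%:E)%E.
Proof.
move=> C0 u0 uC; apply: lime_le; first by apply: is_cvg_nneseries => n _ _.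
apply: nearW => n.
apply: (@le_trans _ _ (\sum_(0 <= k < n) (C * (2 ^+ k)^-1)%:E)%E).
  by apply: lee_sum => k _; exact: uC.
rewrite sumEFin lee_fin.
have -> : \sum_(0 <= k < n) C * (2 ^+ k)^-1 = 2 * C - 2 * C * (2 ^+ n)^-1.
  elim: n => [|n IH]; first by rewrite big_nil expr0 invr1; ring.
  rewrite big_nat_recr//= IH exprS; field.
  by rewrite expf_neq0.
by rewrite gerBl mulr_ge0 ?invr_ge0 ?exprn_ge0// mulr_ge0.
Qed.

Section komlos.
Context d (X : measurableType d) (R : realType) (mu : {measure set X -> \bar R}).
Context (w : X -> R) (W : R).
Context (mw : measurable_fun setT w) (w_gt0 : forall x, 0 < w x)
  (wW : (\int[mu]_x (w x)%:E = W%:E)%E).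

(** The weighted integral of the sum of the |h n| is finite, so this sum is finite
    almost everywhere. *)
Lemma ae_cvg_series_of_geometric_integrals (h : nat -> X -> R) (C : R) :
  (forall n, measurable_fun setT (h n)) ->
  (forall n, (\int[mu]_x (`|h n x| * w x)%:E <= (C * (2 ^+ n)^-1)%:E)%E) ->
  {ae mu, forall x, cvgn (series (fun n => `|h n x|))}.
Proof.
move=> mh hC.
have m1 n : measurable_fun setT (fun x => (`|h n x| * w x)%:E).
  by apply/measurable_EFinP; apply: measurable_funM => //; exact: measurableT_comp.
have p1 n x : (0 <= (`|h n x| * w x)%:E)%E by rewrite lee_fin mulr_ge0// ltW.
pose F x := (\sum_(n <oo) (`|h n x| * w x)%:E)%E.
have F0 x : (0 <= F x)%E by apply: nneseries_ge0 => n _ _; exact: p1.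
have mF : measurable_fun setT F by apply: ge0_emeasurable_sum.
have C0 : 0 <= C.
  have := hC 0%N; rewrite expr0 invr1 mulr1 -lee_fin; apply: le_trans.
  by apply: integral_ge0 => x _; exact: p1.
have Fint : (\int[mu]_x F x <= (2 * C)%:E)%E.
  rewrite integral_nneseries//; apply: nneseries_le_half => // n.
  by apply: integral_ge0 => x _; exact: p1.
have Fi : mu.-integrable setT F.
  apply/integrableP; split => //.
  under eq_integral do rewrite gee0_abs//.
  by apply: le_lt_trans Fint _; rewrite ltry.
apply: filterS (integrable_ae measurableT Fi) => x /(_ I) Ffin.
apply: nondecreasing_is_cvgn; first exact: nondecreasing_series.
exists (fine (F x) / w x) => _ [n _ <-].
rewrite ler_pdivlMr// -lee_fin fineK// /series /= mulr_suml -sumEFin.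
by apply: nneseries_lim_ge => k _ _; exact: p1.
Qed.

(** The quadratic bounds imply linear ones, through |h| <= 2^n h^2 + 2^-n. *)
Lemma ae_cvg_series_of_quadratic_integrals (h : nat -> X -> R) (q : R) :
  (forall n, measurable_fun setT (h n)) ->
  (forall n, (\int[mu]_x (h n x ^+ 2 * w x)%:E <= (q * (4 ^+ n)^-1)%:E)%E) ->
  {ae mu, forall x, cvgn (series (fun n => `|h n x|))}.
Proof.
move=> mh hq; apply: (@ae_cvg_series_of_geometric_integrals _ (q + W)) => // n.
have mh2 : measurable_fun setT (fun x => h n x ^+ 2 * w x).
  by apply: measurable_funM => //; exact: measurable_funX.
have w_ge0 x : 0 <= w x by exact: ltW.
have h2_ge0 x : 0 <= h n x ^+ 2 * w x by rewrite mulr_ge0 ?sqr_ge0.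
have t_ge0 : 0 <= (2 ^+ n : R) by rewrite exprn_ge0.
have tV_ge0 : 0 <= ((2 ^+ n)^-1 : R) by rewrite invr_ge0.
have th2_ge0 x : 0 <= 2 ^+ n * (h n x ^+ 2 * w x) by rewrite mulr_ge0.
have tw_ge0 x : 0 <= (2 ^+ n)^-1 * w x by rewrite mulr_ge0.
apply: (@le_trans _ _ (\int[mu]_x (2 ^+ n * (h n x ^+ 2 * w x) + (2 ^+ n)^-1 * w x)%:E)%E).
  apply: integralR_le.
  - by move=> x; rewrite mulr_ge0// ltW.
  - by apply: measurable_funM => //; exact: measurableT_comp.
  - apply: measurable_funD; apply: measurable_funM => //.
  move=> x; rewrite mulrA -mulrDl ler_wpM2r ?(ltW (w_gt0 x))//.
  (* either |h| <= 2^-n, or |h| <= 2^n h^2 *)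
  set t := 2 ^+ n; have t0 : 0 < t by rewrite exprn_gt0.
  rewrite -(real_normK (num_real (h n x))); set a := `|h n x|.
  have a0 : 0 <= a by exact: normr_ge0.
  have [ta|ta] := leP a t^-1.
    by rewrite (le_trans ta)// lerDr mulr_ge0 ?sqr_ge0// ltW.
  have : 1 <= t * a by rewrite mulrC -ler_pdivrMr// mul1r ltW.
  have : 0 <= t^-1 by rewrite invr_ge0 ltW.
  nra.
rewrite integralRD//; [|exact: measurable_funM|exact: measurable_funM].
rewrite !integralRZ//.
rewrite wW mulrDl EFinD; apply: leeD; last by rewrite -EFinM mulrC.
apply: (@le_trans _ _ ((2 ^+ n)%:E * (q * (4 ^+ n)^-1)%:E)%E).
  by apply: lee_wpmul2l; rewrite ?lee_fin ?exprn_ge0//; exact: hq.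
rewrite -EFinM lee_fin le_eqVlt; apply/orP; left; apply/eqP.
have -> : (4 : R) ^+ n = 2 ^+ n * 2 ^+ n by rewrite -exprMn -natrM.
by field; rewrite expf_neq0.
Qed.

(** Quantitative strict convexity of a -> 1 / (1 + a) on [0, +oo): with u and v
    the values at a and b, the defect is (u - v)^2 (2 - u - v) / (u + v). *)
Lemma invr1D_midpoint (a b : R) : 0 <= a -> 0 <= b ->
  ((1 + a)^-1 - (1 + b)^-1) ^+ 2 + 4 * (1 + (a + b) / 2)^-1 <=
  2 * (1 + a)^-1 + 2 * (1 + b)^-1.
Proof.
move=> a0 b0; have a1 : 1 + a != 0 by apply/eqP; lra.
have b1 : 1 + b != 0 by apply/eqP; lra.
have c1 : 2 + a + b != 0 by apply/eqP; lra.
rewrite -subr_ge0.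
set u := (1 + a)^-1; set v := (1 + b)^-1.
have u0 : 0 < u by rewrite invr_gt0; lra.
have v0 : 0 < v by rewrite invr_gt0; lra.
have u1 : u <= 1 by rewrite invf_le1; lra.
have v1 : v <= 1 by rewrite invf_le1; lra.
have uv0 : u + v != 0 by rewrite gt_eqF// addr_gt0.
have -> : (1 + (a + b) / 2)^-1 = 2 * u * v / (u + v).
  by rewrite /u /v; field; rewrite a1 b1; repeat (apply/andP; split) => //; apply/eqP; lra.
have -> : 2 * u + 2 * v - ((u - v) ^+ 2 + 4 * (2 * u * v / (u + v))) =
  (u - v) ^+ 2 * (2 - (u + v)) / (u + v) by field.
apply: divr_ge0; last by rewrite addr_ge0 ?ltW.
by rewrite mulr_ge0 ?sqr_ge0//; lra.
Qed.

Context (J : finType).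

(** In the coordinate 1 / (1 + phi) the range [0, +oo] is compact, so the energy
    is finite for all nonnegative phi and limits may be infinite. *)
Definition energy (phi : J -> X -> R) : \bar R :=
  (\int[mu]_x (\sum_j (1 + phi j x)^-1 * w x)%:E)%E.

Let admissible (phi : J -> X -> R) :=
  (forall j, measurable_fun setT (phi j)) /\ (forall j x, 0 <= phi j x).

Let inv_ge0 phi j x : admissible phi -> 0 <= (1 + phi j x)^-1.
Proof. by move=> [_ p0]; rewrite invr_ge0 addr_ge0. Qed.

Let measurable_inv phi j : admissible phi ->
  measurable_fun setT (fun x => (1 + phi j x)^-1).
Proof.
move=> [mp p0]; apply: measurable_invr_ge0; first by move=> x; rewrite addr_ge0.
exact: measurable_funD.
Qed.

Let summand_ge0 phi x : admissible phi -> 0 <= \sum_j (1 + phi j x)^-1 * w x.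
Proof. by move=> hp; apply: sumr_ge0 => j _; rewrite mulr_ge0 ?inv_ge0// ltW. Qed.

Let measurable_summand phi : admissible phi ->
  measurable_fun setT (fun x => \sum_j (1 + phi j x)^-1 * w x).
Proof.
by move=> hp; apply: measurable_sum => j; apply: measurable_funM => //; exact: measurable_inv.
Qed.

Lemma energy_bounds phi : admissible phi -> (0 <= energy phi <= (#|J|%:R * W)%:E)%E.
Proof.
move=> hp; apply/andP; split.
  by apply: integral_ge0 => x _; rewrite lee_fin summand_ge0.
rewrite EFinM -wW -integralRZ//; last by move=> x; rewrite ltW.
apply: integralR_le.
- by move=> x; exact: summand_ge0.
- exact: measurable_summand.
- exact: measurable_funM.
move=> x; rewrite -sum1_card natr_sum mulr_suml; apply: ler_sum => j _.
rewrite ler_wpM2r ?(ltW (w_gt0 x))// invf_le1 ?lerDl ?(hp.2)//.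
by rewrite ltr_pwDl// hp.2.
Qed.

(** Strict convexity of the energy controls the distance of two near-minimisers. *)
Lemma energy_midpoint phi psi j : admissible phi -> admissible psi ->
  (\int[mu]_x (((1 + phi j x)^-1 - (1 + psi j x)^-1) ^+ 2 * w x)%:E +
    4%:E * energy (fun j x => ((phi j x + psi j x) / 2)%R)
   <= 2%:E * energy phi + 2%:E * energy psi)%E.
Proof.
move=> hp hq; pose mid j x := (phi j x + psi j x) / 2; rewrite -/mid.
have hm : admissible mid.
  split=> [i|i x]; last by rewrite divr_ge0// addr_ge0 ?hp.2 ?hq.2.
  by apply: measurable_funM => //; apply: measurable_funD; [exact: hp.1|exact: hq.1].
have mdiff : measurable_fun setT
    (fun x => ((1 + phi j x)^-1 - (1 + psi j x)^-1) ^+ 2 * w x).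
  apply: measurable_funM => //; apply: measurable_funX.
  by apply: measurable_funB; exact: measurable_inv.
have sq0 x : 0 <= ((1 + phi j x)^-1 - (1 + psi j x)^-1) ^+ 2 * w x.
  by rewrite mulr_ge0 ?sqr_ge0// ltW.
have sc (k : R) (c : J -> X -> R) : 0 <= k -> admissible c ->
    (forall x, 0 <= k * (\sum_j (1 + c j x)^-1 * w x)) /\
    measurable_fun setT (fun x => k * (\sum_j (1 + c j x)^-1 * w x)).
  move=> k0 hc; split=> [x|]; first by rewrite mulr_ge0 ?summand_ge0.
  by apply: measurable_funM => //; exact: measurable_summand.
rewrite /energy -!integralRZ//; try by [move=> x; exact: summand_ge0|exact: measurable_summand].
rewrite -!integralRD//; try by [apply: (sc _ _ _ _).1|apply: (sc _ _ _ _).2].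
apply: integralR_le.
- by move=> x; rewrite addr_ge0// (sc _ _ _ _).1.
- by apply: measurable_funD => //; exact: (sc _ _ _ _).2.
- by apply: measurable_funD; exact: (sc _ _ _ _).2.
move=> x; rewrite (bigD1 j)// [X in _ <= 2 * X + _](bigD1 j)// [X in _ <= _ + 2 * X](bigD1 j)//=.
have := invr1D_midpoint (hp.2 j x) (hq.2 j x) => hj.
have {}hj := ler_wpM2r (ltW (w_gt0 x)) hj.
have : 4 * (\sum_(i | i != j) (1 + mid i x)^-1 * w x) <=
  2 * (\sum_(i | i != j) (1 + phi i x)^-1 * w x) +
  2 * (\sum_(i | i != j) (1 + psi i x)^-1 * w x).
  rewrite !mulr_sumr -big_split/=; apply: ler_sum => i _.
  have hi := ler_wpM2r (ltW (w_gt0 x)) (invr1D_midpoint (hp.2 i x) (hq.2 i x)).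
  have : 0 <= ((1 + phi i x)^-1 - (1 + psi i x)^-1) ^+ 2 * w x.
    by rewrite mulr_ge0 ?sqr_ge0// ltW.
  rewrite /mid; lra.
rewrite /mid; lra.
Qed.

(** Near-minimisers of the energy at the level of [sup_inf_level] are close in the
    weighted L^2 distance of 1 / (1 + phi), whenever they lie in a common set whose
    infimum is close to the level.  Elements of different sets are compared
    through a near-minimiser chi in a common refinement.  With errors 4^-n the
    sequence phi n converges almost everywhere, and near-minimisers psi n taken
    in a given D i have the same limit.
    The limit is expressed in the coordinate 1 / (1 + phi). *)
Lemma directed_komlos (I : Type) (i0 : I) (D : I -> set (J -> X -> R)) :
  (forall i phi, D i phi -> forall j, measurable_fun setT (phi j)) ->
  (forall i phi, D i phi -> forall j x, 0 <= phi j x) ->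
  (forall i, D i !=set0) ->
  (forall i k, exists l, D l `<=` D i `&` D k) ->
  (forall i phi psi, D i phi -> D i psi -> D i (fun j x => (phi j x + psi j x) / 2)) ->
  exists2 a : J -> X -> R, forall j, measurable_fun setT (a j) &
    forall i, exists2 psi : nat -> J -> X -> R, forall n, D i (psi n) &
      {ae mu, forall x, forall j, (fun n => (1 + psi n j x)^-1) @ \oo --> a j x}.
Proof.
move=> mD pD D0 dirD midD.
have adm i phi : D i phi -> admissible phi.
  by move=> Dp; split; [exact: mD Dp|exact: pD Dp].
pose E phi := fine (energy phi).
have Efin i phi : D i phi -> energy phi = (E phi)%:E.
  move=> Dp; have /andP[e0 e1] := energy_bounds (adm _ _ Dp).
  by rewrite fineK// ge0_fin_numE// (le_lt_trans e1)// ltry.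
have EM i phi : D i phi -> 0 <= E phi <= #|J|%:R * W.
  by move=> Dp; rewrite -!lee_fin -(Efin _ _ Dp) energy_bounds//; exact: adm Dp.
have [m [lom him]] := sup_inf_level i0 D0 EM.
have close i eps phi psi j : (forall p, D i p -> m - eps < E p) ->
    D i phi -> D i psi -> E phi < m + eps -> E psi < m + eps ->
    (\int[mu]_x (((1 + phi j x)^-1 - (1 + psi j x)^-1) ^+ 2 * w x)%:E <= (8 * eps)%:E)%E.
  move=> lo Dp Dq Ep Eq; have := energy_midpoint j (adm _ _ Dp) (adm _ _ Dq).
  have Dm := midD _ _ _ Dp Dq; have := lo _ Dm.
  rewrite (Efin _ _ Dp) (Efin _ _ Dq) (Efin _ _ Dm).
  rewrite -!EFinM -[X in (_ <= X)%E]EFinD.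
  move=> lo'; rewrite -leeBrDr// => /le_trans; apply; rewrite -EFinB lee_fin; lra.
pose eps n : R := (4 ^+ n)^-1.
have eps0 n : 0 < eps n by rewrite invr_gt0 exprn_gt0.
have epsS n : eps n.+1 <= eps n.
  by rewrite lef_pV2 ?posrE ?exprn_gt0// ler_weXn2l// ler1n.
have [i_ lo_] := @choice _ _ (fun n i => forall p, D i p -> m - eps n < E p)
  (fun n => lom _ (eps0 n)).
have near i n : exists phi, [/\ D i phi, D (i_ n) phi & E phi < m + eps n].
  have [l Dl] := dirD i (i_ n); have [p Dp Ep] := him _ l (eps0 n).
  by exists p; have [] := Dl _ Dp.
(* phi n is a near-minimiser in D (i_ n), chi n links phi n with phi n.+1 *)
have [phi hphi] := choice (near i0).
have [chi hchi] := choice (fun n => near (i_ n) n.+1).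
pose b (p : J -> X -> R) j x := (1 + p j x)^-1.
have mb i p j : D i p -> measurable_fun setT (b p j).
  by move=> Dp; apply: measurable_inv; exact: adm Dp.
have summ (u v : nat -> J -> X -> R) (c : R) : 0 <= c ->
    (forall n, exists2 i, D i (u n) & True) -> (forall n, exists2 i, D i (v n) & True) ->
    (forall n j, (\int[mu]_x ((b (u n) j x - b (v n) j x) ^+ 2 * w x)%:E <=
       (c * eps n)%:E)%E) ->
    {ae mu, forall x j, cvgn (series (fun n => `|b (u n) j x - b (v n) j x|))}.
  move=> c0 Du Dv huv.
  apply: filter_forall => j.
  apply: (@ae_cvg_series_of_quadratic_integrals
    (fun n x => b (u n) j x - b (v n) j x) c) => // n.
  have [i1 D1 _] := Du n; have [i2 D2 _] := Dv n.
  by apply: measurable_funB; [exact: mb D1|exact: mb D2].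
have s1 : {ae mu, forall x j, cvgn (series (fun n => `|b (phi n) j x - b (chi n) j x|))}.
  apply: (summ _ _ 8) => //.
  - by move=> n; exists i0 => //; have [] := hphi n.
  - by move=> n; exists (i_ n) => //; have [] := hchi n.
  move=> n j; have [_ D1 E1] := hphi n; have [D2 _ E2] := hchi n.
  apply: close (lo_ n) _ _ _ _ => //.
  by apply: lt_le_trans E2 _; rewrite lerD2l.
have s2 : {ae mu, forall x j, cvgn (series (fun n => `|b (phi n.+1) j x - b (chi n) j x|))}.
  apply: (summ (fun n => phi n.+1) _ 8) => //.
  - by move=> n; exists i0 => //; have [] := hphi n.+1.
  - by move=> n; exists (i_ n) => //; have [] := hchi n.
  move=> n j; have [_ D1 E1] := hphi n.+1; have [_ D2 E2] := hchi n.
  apply: (@le_trans _ _ (8 * eps n.+1)%:E); last by rewrite lee_fin ler_wpM2l.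
  exact: close (lo_ n.+1) _ _ _ _.
pose a j x := fine (limn_esup (fun n => (b (phi n) j x)%:E)).
have cvga : {ae mu, forall x j, (fun n => b (phi n) j x) @ \oo --> a j x}.
  apply: filterS2 s1 s2 => x h1 h2 j.
  have : cvgn (fun n => b (phi n) j x).
    have -> : (fun n => b (phi n) j x) =
        (fun n => b (phi 0%N) j x + series (telescope (fun n => b (phi n) j x)) n).
      by apply/funext => n; rewrite -eq_sum_telescope.
    apply: is_cvgD; first exact: is_cvg_cst.
    apply: normed_cvg.
    apply: (@series_le_cvg _ _ (fun n => `|b (phi n.+1) j x - b (chi n) j x| +
      `|b (phi n) j x - b (chi n) j x|)) => [n|n|n|].
    - exact: normr_ge0.
    - by rewrite addr_ge0.
    - rewrite /telescope /= -[X in `|X|](subrKA (b (chi n) j x)).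
      by apply: le_trans (ler_normD _ _) _; rewrite (distrC (b (chi n) j x)).
    - have := is_cvg_seriesD (h2 j) (h1 j).
      by [].
  move=> /cvg_ex[l bl]; suff -> : a j x = l by [].
  have bl' : (fun n => (b (phi n) j x)%:E) @ \oo --> l%:E by apply/cvg_EFin => //; exact: nearW.
  by rewrite /a; have [_ ->] := cvg_limn_einf_sup bl'.
exists a.
  move=> j; apply: (@measurableT_comp _ _ _ _ _ _ fine _
    (fun x => limn_esup (fun n => (b (phi n) j x)%:E))) => //.
  apply: (measurable_fun_limn_esup (f := fun n x => (b (phi n) j x)%:E)) => n.
  by apply/measurable_EFinP; apply: mb; have [+ _ _] := hphi n; exact.
move=> i; have [psi hpsi] := choice (near i).
exists psi; first by move=> n; have [] := hpsi n.
have s3 : {ae mu, forall x j, cvgn (series (fun n => `|b (psi n) j x - b (phi n) j x|))}.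
  apply: (summ _ _ 8) => //.
  - by move=> n; exists i => //; have [] := hpsi n.
  - by move=> n; exists i0 => //; have [] := hphi n.
  move=> n j; have [_ D1 E1] := hpsi n; have [_ D2 E2] := hphi n.
  exact: close (lo_ n) _ _ _ _.
apply: filterS2 cvga s3 => x ha h3 j.
have h0 : (fun n => b (psi n) j x - b (phi n) j x) @ \oo --> 0.
  by apply/norm_cvg0P; exact: cvg_series_cvg_0 (h3 j).
rewrite -[a j x]add0r.
have -> : (fun n => (1 + psi n j x)^-1) =
  (fun n => (b (psi n) j x - b (phi n) j x) + b (phi n) j x).
  by apply/funext => n; rewrite subrK.
exact: cvgD h0 (ha j).
Qed.

End komlos.

(** * Concavity of geometric means *)

Section geometric_means.
Context (R : realType).

Lemma prod_powR_const (I : finType) (th : I -> R) (H : R) : (forall i, 0 < th i) ->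
  \sum_i th i = 1 -> 0 <= H -> \prod_i H `^ th i = H.
Proof.
move=> th0 th1 H0; have [->|Hn0] := eqVneq H 0.
  have [i _|I0] := pickP (@predT I).
    by rewrite (bigD1 i)//= powR0 ?gt_eqF// mul0r.
  by have := oner_neq0 R; rewrite -th1 (eq_bigl _ _ I0) big_pred0_eq eqxx.
have -> : \prod_i H `^ th i = \prod_i expR (th i * ln H).
  by apply: eq_bigr => i _; rewrite /powR (negbTE Hn0).
by rewrite -expR_sum -mulr_suml th1 mul1r lnK// posrE lt_neqAle eq_sym Hn0.
Qed.

Lemma prod_powR_ge0 (I : finType) (th g : I -> R) : 0 <= \prod_i g i `^ th i.
Proof. by apply: prodr_ge0 => i _; exact: powR_ge0. Qed.

(** One coordinate of a geometric mean goes from gs to gs' as its part u moves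
    the fraction t of the way to f.  Concavity bounds the mean from above by its tangent at
    the new point gs'; comparability of gs and gs' then lets the density
    gs^th / gs of the old point replace that of the new one. *)
Lemma tangent_step (th t u s f : R) : 0 < th <= 1 -> 0 <= t <= 2^-1 ->
  0 <= u -> 0 <= s -> 0 <= f -> t * f <= u + s ->
  let gs := (u + s) / 2 in let gs' := ((1 - t) * u + t * f + s) / 2 in
  gs `^ th + th * t / 8 * (gs `^ th / gs * f) <= gs' `^ th * (1 + 2 * th * t).
Proof.
move=> /andP[th0 th1] /andP[t0 t2] u0 s0 f0 tf /=.
set gs := (u + s) / 2; set gs' := (_ + s) / 2.
have gs0 : 0 <= gs by rewrite divr_ge0 ?addr_ge0.
have gs'0 : 0 <= gs'.
  by rewrite divr_ge0// addr_ge0// addr_ge0// mulr_ge0//; lra.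
have [gsz|gsn0] := eqVneq gs 0.
  rewrite gsz powR0 ?gt_eqF// !mul0r mulr0 addr0 mulr_ge0 ?powR_ge0//.
  by rewrite addr_ge0// mulr_ge0// mulr_ge0// ltW.
have gsp : 0 < gs by rewrite lt_neqAle eq_sym gsn0.
have tu0 : 0 <= t * u by rewrite mulr_ge0.
have tf0 : 0 <= t * f by rewrite mulr_ge0.
have ut : t * u <= u / 2 by rewrite mulrC ler_wpM2l.
have lo : gs / 2 <= gs' by rewrite /gs /gs'; lra.
have gs'p : 0 < gs' by apply: lt_le_trans lo; rewrite divr_gt0.
have up : gs' <= 2 * gs by rewrite /gs /gs'; lra.
have gg0 : 0 <= gs / gs' by exact: divr_ge0.
have tang : gs `^ th <= gs' `^ th * (1 + th * (gs / gs' - 1)).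
  have -> : gs `^ th = gs' `^ th * (gs / gs') `^ th.
    by rewrite -powRM// mulrCA divff ?gt_eqF// mulr1.
  by rewrite ler_wpM2l ?powR_ge0// powR_le_tangent// (ltW th0).
set P' := gs' `^ th in tang *; set P := gs `^ th in tang *.
have P0 : 0 <= P by exact: powR_ge0.
have P'0 : 0 <= P' by exact: powR_ge0.
have PP' : P / 2 <= P'.
  apply: (@le_trans _ _ ((gs / 2) `^ th)); last first.
    by apply: ge0_ler_powR; rewrite ?nnegrE// ?(ltW th0)//; exact: divr_ge0.
  rewrite powRM// ler_wpM2l// -[leLHS](@powRr1 R)//.
  by apply: ger_powR => //; rewrite invr_gt0 ltr0n invf_le1//= ler1n.
have ratio : P / gs / 4 <= P' / gs'.
  have -> : P / gs / 4 = P / 2 * (2 * gs)^-1 by field.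
  have P20 : 0 <= P / 2 by exact: divr_ge0.
  have gs20 : 0 < 2 * gs by exact: mulr_gt0.
  apply: ler_pM => //; first by rewrite invr_ge0 ltW.
  by rewrite lef_pV2.
have expand : P' * (1 + th * (gs / gs' - 1)) =
   P' + th * t / 2 * (P' / gs') * u - th * t / 2 * (P' / gs' * f).
  rewrite /gs; have -> : u + s = 2 * gs' + t * u - t * f by rewrite /gs'; field.
  by field; rewrite gt_eqF.
have uu : P' / gs' * u <= 4 * P'.
  have u4 : u <= 4 * gs' by rewrite /gs'; lra.
  have -> : 4 * P' = P' / gs' * (4 * gs') by field; rewrite gt_eqF.
  by apply: ler_wpM2l => //; exact: divr_ge0.
have h1 : th * t / 2 * (P' / gs') * u <= th * t / 2 * (4 * P').
  by rewrite -mulrA; apply: ler_wpM2l => //; rewrite divr_ge0// mulr_ge0// ltW.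
have h2 : th * t / 2 * (P / gs / 4 * f) <= th * t / 2 * (P' / gs' * f).
  rewrite ler_wpM2l ?divr_ge0 ?mulr_ge0// ?(ltW th0)//.
  by rewrite ler_wpM2r.
rewrite expand in tang.
have -> : th * t / 8 * (P / gs * f) = th * t / 2 * (P / gs / 4 * f) by field.
have -> : P' * (1 + 2 * th * t) = P' + th * t / 2 * (4 * P') by field.
lra.
Qed.

(** At l = 0 the power need not be differentiable, and its inverse function gives
    the modulus of continuity. *)
Lemma powR_cvg (th : R) (y : nat -> R) (l : R) : 0 < th -> (forall n, 0 <= y n) ->
  0 <= l -> y @ \oo --> l -> (fun n => y n `^ th) @ \oo --> l `^ th.
Proof.
move=> th0 y0 l0 yl; have [lz|ln0] := eqVneq l 0.
  rewrite lz powR0 ?gt_eqF//; apply/cvgrPdist_le => e e0.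
  have := yl; rewrite lz => /cvgrPdist_le /(_ (e `^ th^-1)).
  rewrite powR_gt0// => /(_ isT); apply: filterS => n.
  rewrite !sub0r !normrN !ger0_norm ?powR_ge0// => h.
  have := ge0_ler_powR (ltW th0) _ _ h; rewrite !nnegrE powR_ge0 => /(_ (y0 n) isT).
  by rewrite -powRrM mulVf ?gt_eqF// powRr1// ltW.
have lp : 0 < l by rewrite lt_neqAle eq_sym ln0.
apply: (continuous_cvg _ (h := fun z => z `^ th)) => //.
apply/differentiable_continuous/derivable1_diffP.
by apply: derivable_powR; rewrite in_itv/= lp.
Qed.

End geometric_means.

(** * Weights from near-maximisers of a geometric mean *)

Section near_maximiser.
Context d (X : measurableType d) (R : realType) (mu : {measure set X -> \bar R}).
Context (J : finType) (theta : J -> R) (G : J -> set (X -> R)) (A : R).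
Context (theta_gt0 : forall j, 0 < theta j) (theta_sum : \sum_j theta j = 1)
  (measurable_G : forall j g, G j g -> measurable_fun setT g)
  (G_ge0 : forall j g, G j g -> forall x, 0 <= g x)
  (convex_G : forall j g h t, G j g -> G j h -> 0 <= t <= 1 ->
     G j (fun x => (1 - t) * g x + t * h x))
  (A_ge0 : 0 <= A)
  (G_bound : forall g, (forall j, G j (g j)) ->
     (\int[mu]_x (\prod_j g j x `^ theta j)%:E <= A%:E)%E).

Lemma theta_le1 j : theta j <= 1.
Proof.
rewrite -theta_sum (bigD1 j)//= lerDl; apply: sumr_ge0 => i _; exact: ltW.
Qed.

Lemma measurable_geomean (g : J -> X -> R) : (forall j, measurable_fun setT (g j)) ->
  measurable_fun setT (fun x => \prod_j g j x `^ theta j).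
Proof.
move=> mg; apply: measurable_prod => j _.
by apply: (measurableT_comp (f := fun y => y `^ theta j)) => //; exact: measurable_powR.
Qed.

Lemma midpoint_G j g h : G j g -> G j h -> G j (fun x => (g x + h x) / 2).
Proof.
move=> Gg Gh; have -> : (fun x => (g x + h x) / 2) =
    (fun x => (1 - 2^-1) * g x + 2^-1 * h x).
  by apply/funext => x; field.
by apply: convex_G => //; lra.
Qed.

Let geo (S g : J -> X -> R) x := \prod_j ((g j x + S j x) / 2) `^ theta j.

Lemma exists_near_maximiser (S : J -> X -> R) (eps : R) :
  (forall j, G j (S j)) -> 0 < eps ->
  exists2 g, forall j, G j (g j) & forall h, (forall j, G j (h j)) ->
    (\int[mu]_x (geo S h x)%:E <= \int[mu]_x (geo S g x)%:E + (eps * A)%:E)%E.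
Proof.
move=> GS eps0.
have geo_ge0 g x : 0 <= geo S g x by exact: prod_powR_ge0.
pose F g := (\int[mu]_x (geo S g x)%:E)%E.
have F0 g : (0 <= F g)%E by apply: integral_ge0 => x _; rewrite lee_fin.
have FA g : (forall j, G j (g j)) -> (F g <= A%:E)%E.
  by move=> Gg; apply: (G_bound (g := fun j x => (g j x + S j x) / 2)) => j; exact: midpoint_G.
have Ffin g : (forall j, G j (g j)) -> F g = (fine (F g))%:E.
  by move=> Gg; rewrite fineK// ge0_fin_numE// (le_lt_trans (FA _ Gg))// ltry.
(* the error eps * A leaves no room if A = 0, but then all integrals vanish *)
have [A0|An0] := eqVneq A 0.
  exists S => // h Gh; rewrite A0 mulr0 adde0.
  by apply: le_trans (FA h Gh) _; rewrite A0; exact: F0.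
have Ap : 0 < A by rewrite lt_neqAle eq_sym An0.
pose V := [set fine (F g) | g in [set g | forall j, G j (g j)]].
have hV : has_sup V.
  split; first by exists (fine (F S)), S.
  by exists A => _ [g Gg <-]; rewrite -lee_fin -Ffin// FA.
have [_ [g Gg <-] hg] := sup_adherent (mulr_gt0 eps0 Ap) hV.
exists g => // h Gh; rewrite -/(F h) -/(F g) (Ffin h)// (Ffin g)// -EFinD lee_fin.
rewrite -lerBlDr; apply: ltW; apply: le_lt_trans hg; rewrite lerB//.
by apply: ub_le_sup; [exact: hV.2|exists h].
Qed.

(** With g a near-maximiser of the integral of the mean H of gs = (g + S) / 2,
    the weight H / gs j is, up to the factor theta j, the derivative of H in the
    j-th coordinate.  Moving g j towards f by the fraction t gains at most t A,
    which bounds the integral of f against the weight.  Domination of f by m S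
    keeps gs j within a factor 2 for t = 1 / (2 (m + 1)), as [tangent_step]
    requires. *)
Lemma exists_local_weights (S : J -> X -> R) (m : nat) : (forall j, G j (S j)) ->
  exists phi : J -> X -> R,
    [/\ forall j, measurable_fun setT (phi j),
        forall j x, 0 <= phi j x,
        forall x, (forall j, 0 < S j x) -> 1 <= \prod_j phi j x `^ theta j
      & forall j f, G j f -> (forall x, f x <= m%:R * S j x) ->
        (\int[mu]_x (f x * phi j x)%:E <= ((16 + 8 / theta j) * A)%:E)%E].
Proof.
move=> GS; pose t : R := (2 * m.+1%:R)^-1.
have m0 : 0 < m.+1%:R :> R by rewrite ltr0n.
have t0 : 0 < t by rewrite invr_gt0 mulr_gt0.
have tm : t * m%:R <= 2^-1.
  rewrite /t invfM -mulrA ger_pMr ?invr_gt0// mulrC ler_pdivrMr// mul1r.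
  by rewrite ler_nat.
have th : t <= 2^-1.
  by rewrite /t lef_pV2 ?posrE ?mulr_gt0// ler_peMr// ler1n.
have [g Gg gmax] := exists_near_maximiser GS t0.
pose gs j x := (g j x + S j x) / 2.
have Ggs j : G j (gs j) by exact: midpoint_G.
pose H x := \prod_j gs j x `^ theta j.
have H0 x : 0 <= H x by exact: prod_powR_ge0.
have gs0 j x : 0 <= gs j x by exact: G_ge0 (Ggs j) x.
have mgs j : measurable_fun setT (gs j) by exact: measurable_G (Ggs j).
have mH : measurable_fun setT H by exact: measurable_geomean.
exists (fun j x => H x / gs j x).
have mphi j : measurable_fun setT (fun x => H x / gs j x).
  by apply: measurable_funM => //; exact: measurable_invr_ge0.
have phi0 j x : 0 <= H x / gs j x by exact: divr_ge0.
split => //.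
  move=> x Sx; have gsp j : 0 < gs j x.
    by rewrite divr_gt0// ltr_wpDl// (G_ge0 (Gg j)).
  have Hp : 0 < H x by apply: prodr_gt0 => j _; exact: powR_gt0.
  suff -> : \prod_j (H x / gs j x) `^ theta j = 1 by [].
  transitivity ((\prod_j H x `^ theta j) / \prod_j gs j x `^ theta j).
    rewrite -prodf_div; apply: eq_bigr => j _.
    by rewrite powRM ?invr_ge0// -[(gs j x)^-1]powR_inv1// -powRrM mulN1r powRN.
  by rewrite prod_powR_const// divff// gt_eqF.
move=> j f Gf fS.
have f0 x : 0 <= f x by exact: G_ge0 Gf x.
have mf : measurable_fun setT f by exact: measurable_G Gf.
(* the competitor: g with its j-th coordinate moved towards f *)
pose h i := if i == j then (fun x => (1 - t) * g j x + t * f x) else g i.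
have Gh i : G i (h i).
  rewrite /h; case: eqP => [->|//]; apply: convex_G => //.
  by rewrite (ltW t0)/=; lra.
pose H' x := \prod_i ((h i x + S i x) / 2) `^ theta i.
have H'0 x : 0 <= H' x by exact: prod_powR_ge0.
have mH' : measurable_fun setT H'.
  by apply: measurable_geomean => i; apply: measurable_G (midpoint_G (Gh i) (GS i)).
have thj0 := theta_gt0 j; have thj1 := theta_le1 j.
pose c := theta j * t / 8; pose c' := 1 + 2 * theta j * t.
have c0 : 0 < c by rewrite divr_gt0// mulr_gt0.
have c'0 : 0 <= c' by rewrite addr_ge0// mulr_ge0 ?mulr_ge0// ltW.
have key x : H x + c * (f x * (H x / gs j x)) <= c' * H' x.
  rewrite /H /H' (bigD1 j)//= [X in _ <= c' * X](bigD1 j)//=.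
  set P := \prod_(i | _) _; have -> : \prod_(i | i != j) ((h i x + S i x) / 2) `^ theta i = P.
    by apply: eq_bigr => i ij; rewrite /h (negbTE ij).
  have P0 : 0 <= P by apply: prodr_ge0 => i _; exact: powR_ge0.
  have hstep : t * f x <= g j x + S j x.
    apply: (@le_trans _ _ (t * (m%:R * S j x))); first by rewrite ler_wpM2l// ltW.
    have Sx := G_ge0 (GS j) x; have gx := G_ge0 (Gg j) x.
    have : t * m%:R * S j x <= 2^-1 * S j x by rewrite ler_wpM2r.
    by lra.
  have := @tangent_step R (theta j) t (g j x) (S j x) (f x).
  rewrite thj0 thj1 (ltW t0) th f0 hstep (G_ge0 (Gg j)) (G_ge0 (GS j)).
  move=> /(_ isT isT isT isT isT isT) /= step.
  have := ler_wpM2l P0 step; rewrite /h eqxx /c /c' -/(gs j x).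
  set q := gs j x `^ theta j; set q' := (_ / 2) `^ theta j => le1.
  rewrite [leLHS](_ : _ = P * (q + theta j * t / 8 * (q / gs j x * f x))); last by ring.
  by rewrite [leRHS](_ : _ = P * (q' * (1 + 2 * theta j * t))); last by ring.
set I := (\int[mu]_x (f x * (H x / gs j x))%:E)%E.
have fphi0 x : 0 <= f x * (H x / gs j x) by rewrite mulr_ge0.
have mfphi : measurable_fun setT (fun x => f x * (H x / gs j x)) by exact: measurable_funM.
have FA (k : J -> X -> R) : (forall i, G i (k i)) ->
    (0 <= \int[mu]_x (geo S k x)%:E <= A%:E)%E.
  move=> Gk; rewrite integral_ge0/= => [|x _]; last by rewrite lee_fin prod_powR_ge0.
  by apply: (G_bound (g := fun i x => (k i x + S i x) / 2)) => i; exact: midpoint_G.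
have int_key : (\int[mu]_x (geo S g x)%:E + c%:E * I <= c'%:E * \int[mu]_x (geo S h x)%:E)%E.
  rewrite -!integralRZ//; last exact: ltW.
  rewrite -integralRD//; last 2 first.
    by move=> x; rewrite mulr_ge0// ltW.
    exact: measurable_funM.
  apply: integralR_le => //.
  - by move=> x; rewrite addr_ge0// mulr_ge0// ltW.
  - by apply: measurable_funD => //; exact: measurable_funM.
  - exact: measurable_funM.
have /andP[Fg0 FgA] := FA g Gg; have /andP[Fh0 FhA] := FA h Gh.
have := gmax h Gh; move: int_key.
have Fgfin : (\int[mu]_x (geo S g x)%:E)%E \is a fin_num.
  by rewrite ge0_fin_numE//; exact: le_lt_trans FgA (ltry _).
have Fhfin : (\int[mu]_x (geo S h x)%:E)%E \is a fin_num.
  by rewrite ge0_fin_numE//; exact: le_lt_trans FhA (ltry _).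
rewrite -(fineK Fgfin) -(fineK Fhfin); rewrite -(fineK Fhfin) lee_fin in FhA.
set u := fine _ in FhA *; set v := fine _ => h1; rewrite -EFinD lee_fin => h2.
have : (c%:E * I <= (t * A + 2 * theta j * t * A)%:E)%E.
  move: h1; rewrite -leeBrDl// => /le_trans; apply.
  rewrite -EFinM -EFinB lee_fin /c'.
  have : theta j * t * u <= theta j * t * A by rewrite ler_wpM2l// mulr_ge0// ltW.
  lra.
rewrite -lee_pdivlMl// => /le_trans; apply; rewrite -EFinM lee_fin /c.
rewrite le_eqVlt; apply/orP; left; apply/eqP; field.
by rewrite !gt_eqF.
Qed.

End near_maximiser.

(** * The disentanglement theorem for convex sets of functions *)

Lemma cvg_ge (R : realType) (u : nat -> R) (l y : R) : u @ \oo --> l ->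
  (forall n, y <= u n) -> y <= l.
Proof.
move=> ul yu; rewrite -(cvg_lim _ ul)//; apply: limr_ge; last exact: nearW.
by apply/cvg_ex; exists l.
Qed.

(** A series of indicators of sets of finite measure, with small coefficients. *)
Lemma exists_finite_weight d (X : measurableType d) (R : realType)
    (mu : {sigma_finite_measure set X -> \bar R}) :
  exists w : X -> R, exists W : R,
    [/\ measurable_fun setT w, forall x, 0 < w x & (\int[mu]_x (w x)%:E = W%:E)%E].
Proof.
have [F TF mF] := sigma_finiteT mu.
pose c n : R := (2 ^+ n)^-1 * (1 + fine (mu (F n)))^-1.
have muF n : (mu (F n) = (fine (mu (F n)))%:E)%E.
  by rewrite fineK// ge0_fin_numE//; exact: (mF n).2.
have muF0 n : 0 <= fine (mu (F n)) by exact: fine_ge0.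
have c0 n : 0 < c n.
  by rewrite mulr_gt0 ?invr_gt0 ?exprn_gt0// ltr_pwDl.
have cle n : c n <= (2 ^+ n)^-1.
  by rewrite ger_pMr ?invr_gt0 ?exprn_gt0// invf_le1 ?lerDl// ltr_pwDl.
have cmu n : c n * fine (mu (F n)) <= (2 ^+ n)^-1.
  rewrite -mulrA ger_pMr ?invr_gt0 ?exprn_gt0// ler_pdivrMl ?ltr_pwDl//.
  by rewrite mulr1 lerDr.
pose u n x : \bar R := (c n * \1_(F n) x)%:E.
have u0 n x : (0 <= u n x)%E by rewrite lee_fin mulr_ge0// ltW.
have mu_ n : measurable_fun setT (u n).
  by apply/measurable_EFinP; apply: measurable_funM => //; apply: measurable_indic; exact: (mF n).1.
pose we x := (\sum_(n <oo) u n x)%E.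
have we2 x : (we x <= (2 * 1)%:E)%E.
  apply: nneseries_le_half => // n; rewrite lee_fin mul1r; apply: le_trans (cle n).
  by rewrite ger_pMr// indicE lern1 leq_b1.
have wefin x : we x \is a fin_num.
  by rewrite ge0_fin_numE ?nneseries_ge0// (le_lt_trans (we2 x))// ltry.
have weE x : we x = (fine (we x))%:E by rewrite fineK.
have mwe : measurable_fun setT we by exact: ge0_emeasurable_sum.
have Iwe : (\int[mu]_x we x <= (2 * 1)%:E)%E.
  rewrite integral_nneseries//; apply: nneseries_le_half => // n.
    by apply: integral_ge0 => x _.
  rewrite /u integralRZ ?(ltW (c0 n))//; last by apply: measurable_indic; exact: (mF n).1.
  rewrite integral_indic//; last exact: (mF n).1.
  rewrite setIT [X in (_ * X <= _)%E](_ : _ = (fine (mu (F n)))%:E); last exact: muF.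
  by rewrite -EFinM lee_fin mul1r.
exists (fine \o we), (fine (\int[mu]_x we x)%E); split.
- exact: measurableT_comp.
- move=> x; have : [set: X] x by [].
  rewrite TF => -[n _ Fnx]; apply: lt_le_trans (c0 n) _.
  rewrite -lee_fin /= -weE.
  have := @nneseries_lim_ge R (fun n => u n x) xpredT 0%N n.+1 (fun n _ _ => u0 n x).
  apply: le_trans; rewrite big_nat_recr//= /u indicE mem_set// mulr1.
  by apply: leeDr; apply: sume_ge0 => i _; exact: u0.
- under eq_integral do rewrite /= -weE.
  rewrite fineK// ge0_fin_numE ?(le_lt_trans Iwe) ?ltry//.
  by apply: integral_ge0 => x _; rewrite nneseries_ge0.
Qed.

Section disentanglement.
Context d (X : measurableType d) (R : realType)
  (mu : {sigma_finite_measure set X -> \bar R}).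
Context (J : finType) (theta : J -> R) (G : J -> set (X -> R)) (A : R).
Context (theta_gt0 : forall j, 0 < theta j) (theta_sum : \sum_j theta j = 1)
  (measurable_G : forall j g, G j g -> measurable_fun setT g)
  (G_ge0 : forall j g, G j g -> forall x, 0 <= g x)
  (convex_G : forall j g h t, G j g -> G j h -> 0 <= t <= 1 ->
     G j (fun x => (1 - t) * g x + t * h x))
  (A_ge0 : 0 <= A)
  (G_bound : forall g, (forall j, G j (g j)) ->
     (\int[mu]_x (\prod_j g j x `^ theta j)%:E <= A%:E)%E)
  (G_neq0 : forall j, G j !=set0)
  (G_saturating : forall E : set X, measurable E -> (0 < mu E)%E ->
     exists E' : set X, [/\ measurable E', E' `<=` E, (0 < mu E')%E &
       exists2 S : J -> X -> R, forall j, G j (S j) &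
         {ae mu, forall x, E' x -> forall j, 0 < S j x}]).

Let bound j := (16 + 8 / theta j) * A.

(** By the inequality of arithmetic and geometric means in each coordinate, the
    square of the mean at the midpoint is at least the product of the means. *)
Lemma mean_powR_midpoint (a b : J -> R) : (forall j, 0 <= a j) -> (forall j, 0 <= b j) ->
  1 <= \prod_j a j `^ theta j -> 1 <= \prod_j b j `^ theta j ->
  1 <= \prod_j ((a j + b j) / 2) `^ theta j.
Proof.
move=> a0 b0 ha hb; set m := \prod_j _.
have m0 : 0 <= m by exact: prod_powR_ge0.
rewrite -(@ler_pXn2r _ 2)// ?nnegrE// expr1n.
apply: le_trans (_ : (\prod_j a j `^ theta j) * (\prod_j b j `^ theta j) <= _).
  by rewrite -[leLHS]mulr1; apply: ler_pM.
rewrite /m -big_split/= -prodrXl; apply: ler_prod => j _.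
rewrite mulr_ge0 ?powR_ge0//=.
have h0 : 0 <= (a j + b j) / 2 by rewrite divr_ge0// addr_ge0.
rewrite expr2 -!powRM//; apply: ge0_ler_powR; rewrite ?nnegrE; first exact: ltW.
- exact: mulr_ge0.
- exact: mulr_ge0.
- by have := sqr_ge0 (a j - b j); lra.
Qed.

(** The sets D (S, m) of the weights given by [exists_local_weights] are convex,
    and any two of them contain a third, with S a midpoint and m larger.  For f in
    G j, Fatou's lemma bounds the integral of f phi j for their common limit phi;
    so phi j is finite almost everywhere on the set where f > 0.  The product
    condition therefore passes to the limit where all the S j are positive, and
    saturation leaves no room outside such sets. *)
Theorem disentanglement : exists phi : J -> X -> R,
  [/\ forall j, measurable_fun setT (phi j),
      forall j x, 0 <= phi j x,
      {ae mu, forall x, 1 <= \prod_j phi j x `^ theta j}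
    & forall j f, G j f -> (\int[mu]_x (f x * phi j x)%:E <= (bound j)%:E)%E].
Proof.
have [w [W [mw w0 wW]]] := exists_finite_weight mu.
pose Ix := ({S : J -> X -> R | forall j, G j (S j)} * nat)%type.
pose S_ (i : Ix) := proj1_sig i.1.
have GS (i : Ix) j : G j (S_ i j) by exact: (proj2_sig i.1).
have [S0 GS0] := choice G_neq0.
pose D (i : Ix) : set (J -> X -> R) := [set phi : J -> X -> R |
  [/\ forall j, measurable_fun setT (phi j),
      forall j x, 0 <= phi j x,
      forall x, (forall j, 0 < S_ i j x) -> 1 <= \prod_j phi j x `^ theta j
    & forall j f, G j f -> (forall x, f x <= i.2%:R * S_ i j x) ->
        (\int[mu]_x (f x * phi j x)%:E <= (bound j)%:E)%E]].
have D0 i : D i !=set0.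
  have [phi hphi] := exists_local_weights theta_gt0 theta_sum measurable_G G_ge0
    convex_G A_ge0 G_bound i.2 (GS i).
  by exists phi.
have dirD i k : exists l, D l `<=` D i `&` D k.
  have GM j : G j (fun x => (S_ i j x + S_ k j x) / 2) by exact: midpoint_G.
  exists (exist _ _ GM, (2 * (i.2 + k.2))%N) => phi [mphi phi0 hprod hint].
  have S_M j x n : S_ (exist _ _ GM, n) j x = (S_ i j x + S_ k j x) / 2 by [].
  have Si j x := G_ge0 (GS i j) x; have Sk j x := G_ge0 (GS k j) x.
  split; split => //.
  - by move=> x Sx; apply: hprod => j; rewrite S_M divr_gt0// ltr_pwDl.
  - move=> j f Gf fS; apply: hint => // x; apply: le_trans (fS x) _.
    rewrite S_M /= natrM natrD; have := Si j x; have := Sk j x.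
    have a0 : 0 <= i.2%:R :> R by []; have b0 : 0 <= k.2%:R :> R by [].
    by move=> s1 s2; nra.
  - by move=> x Sx; apply: hprod => j; rewrite S_M divr_gt0// ltr_wpDl.
  - move=> j f Gf fS; apply: hint => // x; apply: le_trans (fS x) _.
    rewrite S_M /= natrM natrD; have := Si j x; have := Sk j x.
    have a0 : 0 <= i.2%:R :> R by []; have b0 : 0 <= k.2%:R :> R by [].
    by move=> s1 s2; nra.
have midD i phi psi : D i phi -> D i psi -> D i (fun j x => (phi j x + psi j x) / 2).
  move=> [m1 p1 h1 i1] [m2 p2 h2 i2]; split.
  - by move=> j; apply: measurable_funM => //; exact: measurable_funD.
  - by move=> j x; rewrite divr_ge0// addr_ge0.
  - by move=> x Sx; apply: mean_powR_midpoint => //; [exact: h1|exact: h2].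
  - move=> j f Gf fS; have f0 := G_ge0 Gf; have mf := measurable_G Gf.
    have -> : (fun x => (f x * ((phi j x + psi j x) / 2))%:E) =
        (fun x => (2^-1 * (f x * phi j x) + 2^-1 * (f x * psi j x))%:E).
      by apply/funext => x; congr EFin; field.
    have q1 x : 0 <= f x * phi j x by rewrite mulr_ge0.
    have q2 x : 0 <= f x * psi j x by rewrite mulr_ge0.
    have r1 x : 0 <= 2^-1 * (f x * phi j x) by rewrite mulr_ge0.
    have r2 x : 0 <= 2^-1 * (f x * psi j x) by rewrite mulr_ge0.
    have n1 : measurable_fun setT (fun x => f x * phi j x) by exact: measurable_funM.
    have n2 : measurable_fun setT (fun x => f x * psi j x) by exact: measurable_funM.
    rewrite integralRD//; [|exact: measurable_funM|exact: measurable_funM].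
    rewrite !integralRZ//.
    have -> : ((bound j)%:E = 2^-1%:E * (bound j)%:E + 2^-1%:E * (bound j)%:E)%E.
      by rewrite -!EFinM -EFinD; congr EFin; field.
    by apply: leeD; apply: lee_wpmul2l; rewrite ?lee_fin//; [exact: i1|exact: i2].
pose i0 : Ix := (exist _ S0 GS0, 0%N).
have [a ma ha] := directed_komlos mw w0 wW i0
  (fun i phi (h : D i phi) => let: And4 h1 _ _ _ := h in h1)
  (fun i phi (h : D i phi) => let: And4 _ h2 _ _ := h in h2) D0 dirD midD.
(* a is the limit of 1 / (1 + psi n), and 0 where psi n tends to infinity *)
pose phi j x := Num.max 0 ((Num.max 0 (a j x))^-1 - 1).
have phi0 j x : 0 <= phi j x by rewrite le_max lexx.
have mphi j : measurable_fun setT (phi j).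
  apply: measurable_maxr => //; apply: measurable_funB => //.
  by apply: measurable_invr_ge0; [move=> x; rewrite le_max lexx|exact: measurable_maxr].
have psi_cvg (psi : nat -> R) (l : R) : (forall n, 0 <= psi n) ->
    (fun n => (1 + psi n)^-1) @ \oo --> l ->
    0 <= l /\ (0 < l -> psi @ \oo --> Num.max 0 ((Num.max 0 l)^-1 - 1)).
  move=> psi0 psil; have l0 : 0 <= l.
    by apply: (cvg_ge psil) => n; rewrite invr_ge0 addr_ge0.
  split => // lp; rewrite (max_r l0).
  have cv : psi @ \oo --> l^-1 - 1.
    have -> : psi = (fun n => ((1 + psi n)^-1)^-1 - 1).
      by apply/funext => n; rewrite invrK addrAC subrr add0r.
    apply: cvgB; last exact: cvg_cst.
    by apply: cvgV => //; rewrite gt_eqF.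
  by rewrite max_r//; exact: (cvg_ge cv).
(* S contains f in the j-th place, so that the weights psi n bound f itself *)
have Fatou j f : G j f -> (\int[mu]_x (f x * phi j x)%:E <= (bound j)%:E)%E /\
    {ae mu, forall x, 0 < f x -> 0 < a j x}.
  move=> Gf; have f0 := G_ge0 Gf; have mf := measurable_G Gf.
  pose S k := if k == j then f else S0 k.
  have GSf k : G k (S k) by rewrite /S; case: eqP => [->|].
  pose i : Ix := (exist _ S GSf, 1%N).
  have [psi Dpsi psia] := ha i.
  have mpsi n k : measurable_fun setT (psi n k) by have [] := Dpsi n.
  have psi0 n k x : 0 <= psi n k x by have [] := Dpsi n.
  have Ipsi n : (\int[mu]_x (f x * psi n j x)%:E <= (bound j)%:E)%E.
    have [_ _ _] := Dpsi n; apply => // x.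
    by rewrite /S_/= /S eqxx mul1r.
  have pos n x : (0 <= (f x * psi n j x)%:E)%E by rewrite lee_fin mulr_ge0.
  have mfp n : measurable_fun setT (fun x => (f x * psi n j x)%:E).
    by apply/measurable_EFinP; exact: measurable_funM.
  pose L x := limn_einf (fun n => (f x * psi n j x)%:E).
  have mL : measurable_fun setT L.
    rewrite /L /limn_einf; apply: measurableT_comp => //.
    apply: (measurable_fun_limn_esup (f := fun n x => (- (f x * psi n j x)%:E)%E)) => n.
    exact: measurableT_comp.
  have L0 x : (0 <= L x)%E.
    rewrite /L limn_einf_lim; apply: lime_ge; first exact: is_cvg_einfs.
    by apply: nearW => n; apply: le_ereal_inf_tmp => _ [k _ <-].
  have IL : (\int[mu]_x L x <= (bound j)%:E)%E.
    apply: le_trans (fatou mu measurableT mfp (fun n x _ => pos n x)) _.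
    rewrite limn_einf_lim; apply: lime_le; first exact: is_cvg_einfs.
    apply: nearW => n; apply: le_trans (Ipsi n); apply: ereal_inf_lbound.
    by exists n => //=.
  have Li : mu.-integrable setT L.
    apply/integrableP; split => //; under eq_integral do rewrite gee0_abs//.
    by apply: le_lt_trans IL _; rewrite ltry.
  split.
    apply: le_trans IL; apply: ae_ge0_le_integral => //.
    - by move=> x _; rewrite lee_fin mulr_ge0.
    - by apply/measurable_EFinP; exact: measurable_funM.
    apply: filterS psia => x /(_ j) psix _.
    have [a0 ax] := psi_cvg _ _ (fun n => psi0 n j x) psix.
    have [az|an0] := eqVneq (a j x) 0.
      rewrite /phi az maxxx invr0 sub0r max_l ?lerN10// mulr0; exact: L0.
    have ap : 0 < a j x by rewrite lt_neqAle eq_sym an0.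
    suff -> : L x = (f x * phi j x)%:E by [].
    apply: (cvg_limn_einf_sup _).1; apply/cvg_EFin; first exact: nearW.
    by apply: cvgM; [exact: cvg_cst|exact: ax].
  apply: filterS2 psia (integrable_ae measurableT Li) => x /(_ j) psix /(_ I) Lfin fx.
  have [a0 ax] := psi_cvg _ _ (fun n => psi0 n j x) psix.
  rewrite lt_neqAle a0 andbT; apply/eqP => az; rewrite -az in psix.
  suff Ly : L x = +oo%E by rewrite Ly in Lfin.
  have psiy : (fun n => 1 + psi n j x) @ \oo --> +oo.
    by apply/gtr0_cvgV0 => //; apply: nearW => n; rewrite ltr_pwDl.
  apply: (cvg_limn_einf_sup _).1; apply/cvgeryP/cvgryPge => M.
  have := psiy; move=> /cvgryPge /(_ (M / f x + 1)); apply: filterS => n.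
  by rewrite [leRHS]addrC lerD2r ler_pdivrMr// mulrC.
have prod_ge1 (S : J -> X -> R) : (forall j, G j (S j)) ->
    {ae mu, forall x, (forall j, 0 < S j x) -> 1 <= \prod_j phi j x `^ theta j}.
  move=> GS'; pose i : Ix := (exist _ S GS', 0%N).
  have [psi Dpsi psia] := ha i.
  have hpos : {ae mu, forall x j, 0 < S j x -> 0 < a j x}.
    by apply: filter_forall => j; exact: (Fatou j _ (GS' j)).2.
  apply: filterS2 psia hpos => x psix apos Sx.
  have psi0 n k y : 0 <= psi n k y by have [] := Dpsi n.
  have cv : (fun n => \prod_j psi n j x `^ theta j) @ \oo --> \prod_j phi j x `^ theta j.
    have cvj j : (fun n => psi n j x `^ theta j) @ \oo --> phi j x `^ theta j.
      apply: powR_cvg => //.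
      have [_] := psi_cvg _ _ (fun n => psi0 n j x) (psix j).
      by apply; exact: apos.
    elim: (index_enum J) => [|k s IH].
      by rewrite big_nil; under eq_fun do rewrite big_nil; exact: cvg_cst.
    by rewrite big_cons; under eq_fun do rewrite big_cons; exact: cvgM.
  apply: (cvg_ge cv) => n.
  by have [_ _ + _] := Dpsi n; apply.
exists phi; split => //; last by move=> j f Gf; exact: (Fatou j f Gf).1.
pose p x := \prod_j phi j x `^ theta j.
have mp : measurable_fun setT p by exact: measurable_geomean.
(* saturation cannot find a subset of positive measure where the product is
   less than 1 *)
pose Z := p @^-1` `]-oo, 1[.
have mZ : measurable Z by rewrite -[Z]setTI; apply: mp.
have [Z0|Zpos] := eqVneq (mu Z) 0%E.
  exists Z; split => // x /= /negP; rewrite -ltNge => hx.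
  by rewrite /Z /= in_itv.
have [] := G_saturating mZ; first by rewrite lt0e Zpos/=.
move=> E' [mE' E'Z E'pos [S GS' Spos]].
suff : mu E' = 0%E by move=> E'0; rewrite E'0 ltxx in E'pos.
apply: measure_negligible => //.
have : {ae mu, forall x, ~ E' x}.
  apply: filterS2 Spos (prod_ge1 S GS') => x h1 h2 E'x.
  have := E'Z x E'x; rewrite /Z /= in_itv/= ltNge.
  by rewrite h2//; exact: h1.
by apply: negligibleS => x /= E'x; exact.
Qed.

End disentanglement.

(** * Real and complex scalars *)

Section scalars.
Context (R : realType) (k : scalar_kind).

Definition scalar_of_real : R -> scalar_field R k :=
  match k return R -> scalar_field R k with
  | RealScalars => fun x => x
  | ComplexScalars => fun x => (x%:C)%C
  end.

Definition re_part : scalar_field R k -> R :=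
  match k return scalar_field R k -> R with
  | RealScalars => fun a : R => a
  | ComplexScalars => fun a : R[i] => complex.Re a
  end.

Definition im_part : scalar_field R k -> R :=
  match k return scalar_field R k -> R with
  | RealScalars => fun _ : R => 0
  | ComplexScalars => fun a : R[i] => complex.Im a
  end.

Implicit Types a b : scalar_field R k.

Lemma modulusE a : modulus a = Num.sqrt (re_part a ^+ 2 + im_part a ^+ 2).
Proof.
rewrite /modulus /re_part /im_part; case: k a => [a|[x y]]//=.
by rewrite expr0n/= addr0 sqrtr_sqr.
Qed.

Lemma modulus_ge0 a : 0 <= modulus a.
Proof. by rewrite modulusE sqrtr_ge0. Qed.

Lemma modulus_sqr a : modulus a ^+ 2 = re_part a ^+ 2 + im_part a ^+ 2.
Proof. by rewrite modulusE sqr_sqrtr// addr_ge0 ?sqr_ge0. Qed.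

Lemma re_partD a b : re_part (a + b) = re_part a + re_part b.
Proof. by rewrite /re_part; case: k a b => // -[? ?] [? ?]. Qed.

Lemma im_partD a b : im_part (a + b) = im_part a + im_part b.
Proof. by rewrite /im_part; case: k a b => [? ?|[? ?] [? ?]]//=; rewrite addr0. Qed.

Lemma re_partZ (x : R) a : re_part (scalar_of_real x * a) = x * re_part a.
Proof.
rewrite /re_part /scalar_of_real; case: k a => // -[u v] /=.
by rewrite mul0r subr0.
Qed.

Lemma im_partZ (x : R) a : im_part (scalar_of_real x * a) = x * im_part a.
Proof.
rewrite /im_part /scalar_of_real; case: k a => [?|[u v]] /=; first by rewrite mulr0.
by rewrite mul0r addr0.
Qed.

Lemma re_part0 : re_part 0 = 0.
Proof. by rewrite /re_part; case: k. Qed.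

Lemma im_part0 : im_part 0 = 0.
Proof. by rewrite /im_part; case: k. Qed.

Lemma modulus0 : @modulus R k 0 = 0.
Proof. by rewrite modulusE re_part0 im_part0 expr0n addr0 sqrtr0. Qed.

Lemma modulusZ (x : R) a : 0 <= x -> modulus (scalar_of_real x * a) = x * modulus a.
Proof.
move=> x0; rewrite !modulusE re_partZ im_partZ !exprMn -mulrDr sqrtrM ?sqr_ge0//.
by rewrite sqrtr_sqr ger0_norm.
Qed.

Lemma modulusD_le a b : modulus (a + b) <= modulus a + modulus b.
Proof.
have a0 := modulus_ge0 a; have b0 := modulus_ge0 b.
rewrite -(@ler_pXn2r _ 2)// ?nnegrE ?modulus_ge0 ?addr_ge0//.
rewrite modulus_sqr re_partD im_partD !sqrrD !modulus_sqr.
set p := re_part a; set q := im_part a; set u := re_part b; set v := im_part b.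
suff : p * u + q * v <= modulus a * modulus b by lra.
have [neg|pos] := leP (p * u + q * v) 0.
  by apply: le_trans neg _; rewrite mulr_ge0.
rewrite -(@ler_pXn2r _ 2)// ?nnegrE ?mulr_ge0// ?(ltW pos)//.
rewrite exprMn !modulus_sqr -/p -/q -/u -/v.
by have := sqr_ge0 (p * v - q * u); lra.
Qed.

Lemma re_part_sum (I : Type) (s : seq I) (F : I -> scalar_field R k) :
  re_part (\sum_(i <- s) F i) = \sum_(i <- s) re_part (F i).
Proof. by elim: s => [|i s IH]; rewrite ?big_nil ?re_part0// !big_cons re_partD IH. Qed.

Lemma im_part_sum (I : Type) (s : seq I) (F : I -> scalar_field R k) :
  im_part (\sum_(i <- s) F i) = \sum_(i <- s) im_part (F i).
Proof. by elim: s => [|i s IH]; rewrite ?big_nil ?im_part0// !big_cons im_partD IH. Qed.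

Lemma scalar_measurableP d (T : measurableType d) (f : T -> scalar_field R k) :
  scalar_measurable f <->
  measurable_fun setT (fun x => re_part (f x)) /\ measurable_fun setT (fun x => im_part (f x)).
Proof.
rewrite /scalar_measurable /re_part /im_part; case: k f => f; split => //.
by case.
Qed.

Lemma measurable_modulus d (T : measurableType d) (f : T -> scalar_field R k) :
  scalar_measurable f -> measurable_fun setT (fun x => modulus (f x)).
Proof.
move=> /scalar_measurableP[m1 m2].
rewrite (_ : (fun _ => _) = (fun x => (re_part (f x) ^+ 2 + im_part (f x) ^+ 2) `^ 2^-1)).
  apply: (measurableT_comp (f := fun y => y `^ 2^-1)); first exact: measurable_powR.
  by apply: measurable_funD; exact: measurable_funX.
by apply/funext => x; rewrite modulusE powR12_sqrt// addr_ge0 ?sqr_ge0.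
Qed.

Definition signed_sum N (c : 'I_N -> R) (a : 'I_N -> scalar_field R k)
    (e : {ffun 'I_N -> bool}) : scalar_field R k :=
  \sum_i scalar_of_real ((-1) ^+ e i * Num.sqrt (c i)) * a i.

Lemma modulus_signed_sum N (c : 'I_N -> R) (a : 'I_N -> scalar_field R k) e :
  modulus (signed_sum c a e) =
  sign_norm (fun i => Num.sqrt (c i) * re_part (a i))
            (fun i => Num.sqrt (c i) * im_part (a i)) e.
Proof.
rewrite modulusE /sign_norm /signed_sum /sign_sum re_part_sum im_part_sum.
by congr (Num.sqrt (_ ^+ 2 + _ ^+ 2)); apply: eq_bigr => i _;
  rewrite ?re_partZ ?im_partZ mulrA.
Qed.

Lemma sum_sqr_parts N (c : 'I_N -> R) (a : 'I_N -> scalar_field R k) : (forall i, 0 <= c i) ->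
  \sum_i ((Num.sqrt (c i) * re_part (a i)) ^+ 2 + (Num.sqrt (c i) * im_part (a i)) ^+ 2) =
  \sum_i c i * modulus (a i) ^+ 2.
Proof.
move=> c0; apply: eq_bigr => i _.
by rewrite !exprMn sqr_sqrtr// -mulrDr modulus_sqr.
Qed.

Lemma sqrt_powR (x p : R) : 0 <= x -> Num.sqrt x `^ (2 * p) = x `^ p.
Proof. by move=> x0; rewrite -powR12_sqrt// -powRrM mulrA mulVf// mul1r. Qed.

Lemma signed_sum_lower (L th : R) N (c : 'I_N -> R) (a : 'I_N -> scalar_field R k) :
  (forall (p : R) M (u v : 'I_M -> R), 0 < p <= 2 ->
    Num.sqrt (\sum_i (u i ^+ 2 + v i ^+ 2)) `^ p <=
    L * sign_mean (fun e => sign_norm u v e `^ p)) ->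
  0 < th <= 1 -> (forall i, 0 <= c i) ->
  (\sum_i c i * modulus (a i) ^+ 2) `^ th <=
  L * sign_mean (fun e => modulus (signed_sum c a e) `^ (2 * th)).
Proof.
move=> hL /andP[th0 th1] c0.
under [X in sign_mean X]funext => e do rewrite modulus_signed_sum.
rewrite -sum_sqr_parts// -sqrt_powR.
  by apply: hL; rewrite mulr_gt0//=; lra.
by apply: sumr_ge0 => i _; rewrite addr_ge0 ?sqr_ge0.
Qed.

(** Khintchine's inequality bounds the mean by the power r/2 of a convex
    combination of squares, to which Jensen's inequality applies. *)
Lemma signed_sum_upper (K r : R) N (c : 'I_N -> R) (a : 'I_N -> scalar_field R k) :
  (forall M (u v : 'I_M -> R), sign_mean (fun e => sign_norm u v e `^ r) <=
     K * Num.sqrt (\sum_i (u i ^+ 2 + v i ^+ 2)) `^ r) -> 0 <= K ->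
  2 <= r -> (forall i, 0 <= c i) -> \sum_i c i = 1 ->
  sign_mean (fun e => modulus (signed_sum c a e) `^ r) <=
  K * \sum_i c i * modulus (a i) `^ r.
Proof.
move=> hK K0 r2 c0 c1.
under [X in sign_mean X]funext => e do rewrite modulus_signed_sum.
apply: le_trans (hK _ _ _) _; rewrite ler_wpM2l// sum_sqr_parts//.
have rE : r = 2 * (r / 2) by field.
rewrite {1}rE sqrt_powR; last by apply: sumr_ge0 => i _; rewrite mulr_ge0 ?sqr_ge0.
apply: le_trans (powR_jensen _ c0 c1 _) _; first by lra.
  by move=> i; exact: sqr_ge0.
apply: ler_sum => i _; rewrite ler_wpM2l//.
by rewrite -powR_mulrn ?modulus_ge0// -powRrM -rE.
Qed.

End scalars.

(** * Simple functions and type 2 *)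

Section simple_functions.
Context (R : realType) (k : scalar_kind) d (Y : measurableType d)
  (nu : {measure set Y -> \bar R}) (r : R).
Context (r_ge2 : 2 <= r).
Implicit Types f g : Y -> scalar_field R k.

Definition power_integral f : \bar R := (\int[nu]_y (modulus (f y) `^ r)%:E)%E.

Let r_gt0 : 0 < r. Proof. by apply: lt_le_trans r_ge2. Qed.

Lemma scalar_Lnorm_powR f : (scalar_Lnorm nu r f `^ r)%E = power_integral f.
Proof.
rewrite /scalar_Lnorm poweR_Lnorm; last by rewrite gt_eqF.
apply: eq_integral => y _ /=.
by rewrite ger0_norm ?modulus_ge0.
Qed.

Lemma scalar_Lnorm_ge0 f : (0 <= scalar_Lnorm nu r f)%E.
Proof. exact: Lnorm_ge0. Qed.

Lemma scalar_Lnorm_ltey f : (scalar_Lnorm nu r f < +oo)%E <-> (power_integral f < +oo)%E.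
Proof.
rewrite -scalar_Lnorm_powR; split; first exact: poweR_lty.
by apply: lty_poweRy; rewrite gt_eqF.
Qed.

Lemma measurable_powR_modulus (p : R) f : scalar_measurable f ->
  measurable_fun setT (fun y => modulus (f y) `^ p).
Proof.
move=> mf; apply: (measurableT_comp (f := fun t => t `^ p)); first exact: measurable_powR.
exact: measurable_modulus.
Qed.

Lemma simple_space0 : simple_space nu r (fun _ : Y => 0 : scalar_field R k).
Proof.
split.
- by apply/scalar_measurableP; rewrite re_part0 im_part0; split; exact: measurable_cst.
- by apply: (@sub_finite_set _ _ [set 0]); [move=> _ [y _ <-]|exact: finite_set1].
- apply/scalar_Lnorm_ltey; rewrite /power_integral.
  under eq_integral do rewrite modulus0 powR0 ?gt_eqF//.
  by rewrite integral0.
Qed.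

Lemma simple_space_comb (x : R) f g : simple_space nu r f -> simple_space nu r g ->
  simple_space nu r (fun y => scalar_of_real k x * f y + g y).
Proof.
move=> [mf ff Nf] [mg fg Ng].
have /scalar_measurableP[mf1 mf2] := mf; have /scalar_measurableP[mg1 mg2] := mg.
split.
- apply/scalar_measurableP; split.
    under eq_fun do rewrite re_partD re_partZ.
    by apply: measurable_funD => //; exact: measurable_funM.
  under eq_fun do rewrite im_partD im_partZ.
  by apply: measurable_funD => //; exact: measurable_funM.
- apply: (@sub_finite_set _ _ [set scalar_of_real k x * u + v | u in range f & v in range g]).
    by move=> _ [y _ <-]; exists (f y); [exists y|exists (g y) => //; exists y].
  exact: finite_image2.
- move: Nf Ng => /scalar_Lnorm_ltey Nf /scalar_Lnorm_ltey Ng.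
  apply/scalar_Lnorm_ltey; rewrite /power_integral.
  pose c1 := 2 `^ r * `|x| `^ r; pose c2 : R := 2 `^ r.
  have c10 : 0 <= c1 by rewrite mulr_ge0 ?powR_ge0.
  have c20 : 0 <= c2 by exact: powR_ge0.
  have mF := measurable_powR_modulus r mf; have mG := measurable_powR_modulus r mg.
  have F0 y : 0 <= c1 * modulus (f y) `^ r by rewrite mulr_ge0 ?powR_ge0.
  have G0 y : 0 <= c2 * modulus (g y) `^ r by rewrite mulr_ge0 ?powR_ge0.
  apply: (@le_lt_trans _ _ (\int[nu]_y (c1 * modulus (f y) `^ r + c2 * modulus (g y) `^ r)%:E)%E).
    apply: integralR_le.
    + by move=> y; exact: powR_ge0.
    + apply: measurable_powR_modulus; apply/scalar_measurableP; split.
        under eq_fun do rewrite re_partD re_partZ.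
        by apply: measurable_funD => //; exact: measurable_funM.
      under eq_fun do rewrite im_partD im_partZ.
      by apply: measurable_funD => //; exact: measurable_funM.
    + by apply: measurable_funD; exact: measurable_funM.
    move=> y; apply: (@le_trans _ _ ((`|x| * modulus (f y) + modulus (g y)) `^ r)).
      apply: ge0_ler_powR; rewrite ?nnegrE ?modulus_ge0 ?addr_ge0 ?mulr_ge0 ?modulus_ge0 ?(ltW r_gt0)//.
      apply: le_trans (modulusD_le _ _) _; rewrite lerD2r.
      rewrite modulusE re_partZ im_partZ !exprMn -mulrDr sqrtrM ?sqr_ge0// sqrtr_sqr.
      by rewrite -modulusE.
    apply: le_trans (powR_add_le _ _ _) _; rewrite ?mulr_ge0 ?modulus_ge0 ?(ltW r_gt0)//.
    by rewrite powRM ?modulus_ge0// mulrDr mulrA.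
  rewrite integralRD//; [|exact: measurable_funM|exact: measurable_funM].
  rewrite !integralRZ//; try by move=> y; exact: powR_ge0.
  apply: lte_add_pinfty; apply: lte_mul_pinfty; rewrite ?lee_fin//.
Qed.

Lemma simple_space_sum (I : Type) (s : seq I) (x : I -> R) (f : I -> Y -> scalar_field R k) :
  (forall i, simple_space nu r (f i)) ->
  simple_space nu r (fun y => \sum_(i <- s) scalar_of_real k (x i) * f i y).
Proof.
move=> Sf; elim: s => [|i s IH].
  by under eq_fun do rewrite big_nil; exact: simple_space0.
by under eq_fun do rewrite big_cons; exact: simple_space_comb.
Qed.

(** Random signed combinations have type 2 in L^r: the mean of the r-th powers
    of the norms is controlled by Khintchine's inequality at each point and by
    convexity of the power r/2. *)
Lemma mean_power_integral_signed_sum (K : R) N (c : 'I_N -> R)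
    (f : 'I_N -> Y -> scalar_field R k) :
  (forall M (u v : 'I_M -> R), sign_mean (fun e => sign_norm u v e `^ r) <=
     K * Num.sqrt (\sum_i (u i ^+ 2 + v i ^+ 2)) `^ r) -> 0 <= K ->
  (forall i, 0 <= c i) -> \sum_i c i = 1 -> (forall i, simple_space nu r (f i)) ->
  (forall i, power_integral (f i) <= 1)%E ->
  sign_mean (fun e => fine (power_integral (fun y => signed_sum c (f^~ y) e))) <= K.
Proof.
move=> hK K0 c0 c1 Sf f1.
have SF e : simple_space nu r (fun y => signed_sum c (f^~ y) e).
  exact: simple_space_sum.
have Pfin e : power_integral (fun y => signed_sum c (f^~ y) e) \is a fin_num.
  rewrite ge0_fin_numE; last by apply: integral_ge0 => y _; rewrite lee_fin powR_ge0.
  by apply/scalar_Lnorm_ltey; have [] := SF e.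
have mF e : measurable_fun setT (fun y => modulus (signed_sum c (f^~ y) e) `^ r).
  by apply: measurable_powR_modulus; have [] := SF e.
have mf i : measurable_fun setT (fun y => modulus (f i y) `^ r).
  by apply: measurable_powR_modulus; have [] := Sf i.
have V0 : 0 <= (2 ^+ N)^-1 :> R by rewrite invr_ge0 exprn_ge0.
rewrite /sign_mean -lee_fin EFinM -sumEFin.
under eq_bigr do rewrite fineK//.
rewrite -integralR_sum//; last by move=> e y; exact: powR_ge0.
rewrite -integralRZ//; last 2 first.
  by move=> y; apply: sumr_ge0 => e _; exact: powR_ge0.
  exact: measurable_sum.
apply: (@le_trans _ _ (\int[nu]_y (K * (\sum_i c i * modulus (f i y) `^ r))%:E)%E).
  apply: integralR_le.
  - by move=> y; rewrite mulr_ge0// sumr_ge0// => e _; exact: powR_ge0.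
  - by apply: measurable_funM => //; exact: measurable_sum.
  - by apply: measurable_funM => //; apply: measurable_sum => i; exact: measurable_funM.
  by move=> y; exact: signed_sum_upper.
rewrite integralRZ//; last 2 first.
  by move=> y; apply: sumr_ge0 => i _; rewrite mulr_ge0 ?powR_ge0.
  by apply: measurable_sum => i; exact: measurable_funM.
rewrite integralR_sum//; last 2 first.
  by move=> i y; rewrite mulr_ge0 ?powR_ge0.
  by move=> i; exact: measurable_funM.
rewrite -[leRHS]mule1; apply: lee_wpmul2l; rewrite ?lee_fin//.
apply: (@le_trans _ _ (\sum_i (c i)%:E)%E); last by rewrite sumEFin c1.
apply: lee_sum => i _; rewrite integralRZ//; last by move=> y; exact: powR_ge0.
by rewrite -[leRHS]mule1; apply: lee_wpmul2l; rewrite ?lee_fin//; exact: f1.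
Qed.

End simple_functions.

(** * Operators and convex hulls of squares *)

Section operators.
Context (R : realType) (k : scalar_kind) dX (X : measurableType dX)
  (mu : {measure set X -> \bar R}) dY (Y : measurableType dY)
  (nu : {measure set Y -> \bar R}) (r : R)
  (T : (Y -> scalar_field R k) -> (X -> scalar_field R k)).
Context (r_ge2 : 2 <= r) (linT : linear_operator mu (simple_space nu r) T).

Lemma linear_operator0 : {ae mu, forall x, T (fun=> 0) x = 0}.
Proof.
have S0 := @simple_space0 R k _ Y nu r r_ge2.
have := linT.2 (-1) _ _ S0 S0.
have -> : (fun y : Y => -1 * 0 + 0 : scalar_field R k) = (fun=> 0).
  by apply/funext => y; rewrite mulr0 addr0.
by apply: filterS => x ->; rewrite mulN1r addNr.
Qed.

Lemma linear_operator_sum (I : Type) (s : seq I) (c : I -> R)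
    (f : I -> Y -> scalar_field R k) : (forall i, simple_space nu r (f i)) ->
  {ae mu, forall x, T (fun y => \sum_(i <- s) scalar_of_real k (c i) * f i y) x =
                    \sum_(i <- s) scalar_of_real k (c i) * T (f i) x}.
Proof.
move=> Sf; elim: s => [|i s IH].
  have -> : (fun y => \sum_(i <- [::]) scalar_of_real k (c i) * f i y) = (fun=> 0).
    by apply/funext => y; rewrite big_nil.
  by apply: filterS linear_operator0 => x ->; rewrite big_nil.
have -> : (fun y => \sum_(j <- i :: s) scalar_of_real k (c j) * f j y) =
    (fun y => scalar_of_real k (c i) * f i y + \sum_(j <- s) scalar_of_real k (c j) * f j y).
  by apply/funext => y; rewrite big_cons.
have := linT.2 (scalar_of_real k (c i)) _ _ (Sf i) (simple_space_sum r_ge2 s c Sf).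
by apply: filterS2 IH => x IH ->; rewrite IH big_cons.
Qed.

Lemma linear_operatorZ (c : R) f : simple_space nu r f ->
  {ae mu, forall x, T (fun y => scalar_of_real k c * f y) x = scalar_of_real k c * T f x}.
Proof.
move=> Sf; have := @linear_operator_sum unit [:: tt] (fun=> c) (fun=> f) (fun=> Sf).
have -> : (fun y => \sum_(i <- [:: tt]) scalar_of_real k c * f y) =
    (fun y => scalar_of_real k c * f y).
  by apply/funext => y; rewrite big_seq1.
by apply: filterS => x ->; rewrite big_seq1.
Qed.

(** The convex hull of the squares |T f|^2, for f in the unit ball of the simple
    functions.  The combinations are encoded by sequences whose weights vanish
    from N on: the same sequences then represent the member with any greater
    length, and several members can be given a common length. *)
Definition square_hull : set (X -> R) := [set g |
  exists N (c : nat -> R) (f : nat -> Y -> scalar_field R k),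
    [/\ forall i, 0 <= c i, forall i, (N <= i)%N -> c i = 0, \sum_(i < N) c i = 1,
        forall i, simple_space nu r (f i) /\ (power_integral nu r (f i) <= 1)%E
      & g = fun x => \sum_(i < N) c i * modulus (T (f i) x) ^+ 2]].

Lemma measurable_modulus_sqr f : simple_space nu r f ->
  measurable_fun setT (fun x => modulus (T f x) ^+ 2).
Proof.
by move=> Sf; apply: measurable_funX; apply: measurable_modulus; exact: linT.1.
Qed.

Lemma measurable_square_hull g : square_hull g -> measurable_fun setT g.
Proof.
move=> [N [c [f [_ _ _ Sf ->]]]]; apply: measurable_sum => i.
by apply: measurable_funM => //; apply: measurable_modulus_sqr; exact: (Sf i).1.
Qed.

Lemma square_hull_ge0 g : square_hull g -> forall x, 0 <= g x.
Proof.
move=> [N [c [f [c0 _ _ _ ->]]]] x; apply: sumr_ge0 => i _.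
by rewrite mulr_ge0 ?sqr_ge0.
Qed.

Lemma convex_square_hull g h t : square_hull g -> square_hull h -> 0 <= t <= 1 ->
  square_hull (fun x => (1 - t) * g x + t * h x).
Proof.
move=> [N [c [f [c0 cN c1 Sf ->]]]] [M [c' [f' [c'0 c'M c'1 Sf' ->]]]] /andP[t0 t1].
exists (N + M)%N, (fun i => if (i < N)%N then (1 - t) * c i else t * c' (i - N)%N),
  (fun i => if (i < N)%N then f i else f' (i - N)%N); split.
- by move=> i; case: ifP => _; rewrite mulr_ge0// subr_ge0.
- move=> i NMi; rewrite ltnNge (leq_trans (leq_addr M N) NMi)/=.
  by rewrite c'M ?mulr0// leq_subRL// (leq_trans (leq_addr M N)).
- rewrite big_split_ord/=; under eq_bigr do rewrite ltn_ord.
  under [X in _ + X]eq_bigr do rewrite ltnNge leq_addr/= addKn.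
  by rewrite -!mulr_sumr c1 c'1; ring.
- by move=> i; case: ifP => _.
- apply/funext => x; rewrite big_split_ord/=.
  under [X in _ = X + _]eq_bigr do rewrite ltn_ord -mulrA.
  under [X in _ = _ + X]eq_bigr do rewrite ltnNge leq_addr/= addKn -mulrA.
  by rewrite -!mulr_sumr.
Qed.

Lemma big_ord_padding (V : nmodType) (N M : nat) (F : nat -> V) :
  (N <= M)%N -> (forall i, (N <= i)%N -> F i = 0) -> \sum_(i < M) F i = \sum_(i < N) F i.
Proof.
move=> NM F0; rewrite (big_ord_widen M F NM) [RHS]big_mkcond/=.
by apply: eq_bigr => i _; case: ltnP => // /F0.
Qed.

Lemma square_hull_padding g : square_hull g ->
  exists N, forall M, (N <= M)%N ->
  exists (c : 'I_M -> R) (f : 'I_M -> Y -> scalar_field R k),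
    [/\ forall i, 0 <= c i, \sum_i c i = 1,
        forall i, simple_space nu r (f i) /\ (power_integral nu r (f i) <= 1)%E
      & g = fun x => \sum_i c i * modulus (T (f i) x) ^+ 2].
Proof.
move=> [N [c [f [c0 cN c1 Sf ->]]]]; exists N => M NM.
exists (fun i => c i), (fun i => f i); split => //.
  by rewrite (big_ord_padding NM).
apply/funext => x; rewrite (big_ord_padding (F := fun i => c i * modulus (T (f i) x) ^+ 2) NM)//.
by move=> i Ni; rewrite cN// mul0r.
Qed.

(** Any positive m that is at least the norm will do, so that functions of norm 0
    are not exceptional. *)
Lemma square_hull_scaled f (m : R) : simple_space nu r f -> 0 < m ->
  (scalar_Lnorm nu r f <= m%:E)%E ->
  exists2 g, square_hull g &
    {ae mu, forall x, modulus (T f x) ^+ 2 = m ^+ 2 * g x}.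
Proof.
move=> Sf m0 fm; have r0 : 0 < r by apply: lt_le_trans r_ge2.
pose h y := scalar_of_real k m^-1 * f y.
have Sh : simple_space nu r h.
  rewrite (_ : h = fun y => scalar_of_real k m^-1 * f y + 0).
    exact: simple_space_comb r_ge2 _ _ _ Sf (simple_space0 k nu r_ge2).
  by apply/funext => y; rewrite addr0.
have Ph : (power_integral nu r h <= 1)%E.
  have hE y : modulus (h y) `^ r = (m^-1) `^ r * modulus (f y) `^ r.
    by rewrite modulusZ ?invr_ge0 ?(ltW m0)// powRM ?invr_ge0 ?modulus_ge0// ltW.
  rewrite /power_integral; under eq_integral do rewrite hE.
  rewrite integralRZ ?powR_ge0//; last 2 first.
    by move=> y; exact: powR_ge0.
    by apply: measurable_powR_modulus; have [] := Sf.
  rewrite -/(power_integral nu r f) -scalar_Lnorm_powR//.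
  apply: (@le_trans _ _ (((m^-1) `^ r)%:E * (m%:E `^ r))%E).
    apply: lee_wpmul2l; first by rewrite lee_fin powR_ge0.
    apply: gt0_ler_poweR; rewrite ?(ltW r0)// in_itv/= ?leey ?andbT ?lee_fin ?(ltW m0)//.
    by rewrite scalar_Lnorm_ge0.
  by rewrite poweR_EFin -EFinM -powRM ?invr_ge0 ?(ltW m0)// mulVf ?powR1// gt_eqF.
exists (fun x => modulus (T h x) ^+ 2).
  exists 1%N, (fun i => (i == 0%N)%:R), (fun=> h); split => //.
  - by case.
  - by rewrite big_ord1.
  - by apply/funext => x; rewrite big_ord1 mul1r.
apply: filterS (linear_operatorZ m^-1 Sf) => x ->.
by rewrite modulusZ ?invr_ge0 ?(ltW m0)// exprMn mulrA -exprMn mulfV ?gt_eqF// expr1n mul1r.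
Qed.

End operators.

(** * From squares to square functions *)

Section vector_valued.
Context (R : realType) (J : finType) (theta r : J -> R).
Context (theta_gt0 : forall j, 0 < theta j) (theta_sum : \sum_j theta j = 1)
  (r_ge2 : forall j, 2 <= r j).

(** The multilinear hypothesis is averaged over random signed combinations F j e
    of the functions defining g j, with independent signs e for each j; a product
    of means over the signs is one mean over all tuples of signs.  Below, by
    [signed_sum_lower], each mean controls the square function g j; above, it is
    the mean of a power 2 theta_j <= r_j of a norm, controlled by type 2. *)
Lemma square_hull_bound : exists2 Lam : R, 0 <= Lam &
  forall (k : scalar_kind) (dX : measure_display) (X : measurableType dX)
    (mu : {measure set X -> \bar R})
    (dY : J -> measure_display) (Y : forall j, measurableType (dY j))
    (nu : forall j, {measure set (Y j) -> \bar R})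
    (T : forall j, (Y j -> scalar_field R k) -> (X -> scalar_field R k)) (B : R),
  0 <= B ->
  (forall j, linear_operator mu (simple_space (nu j) (r j)) (T j)) ->
  (forall f : forall j, Y j -> scalar_field R k,
     (forall j, simple_space (nu j) (r j) (f j)) ->
     (\int[mu]_x (\prod_j modulus (T j (f j) x) `^ (2 * theta j))%:E
      <= B%:E * \prod_j scalar_Lnorm (nu j) (r j) (f j) `^ (2 * theta j))%E) ->
  forall g : J -> X -> R, (forall j, square_hull (nu j) (r j) (T j) (g j)) ->
    (\int[mu]_x (\prod_j g j x `^ theta j)%:E <= (Lam * B)%:E)%E.
Proof.
have [L L1 hL] := @khintchine_lower R.
have /choice[K hK] : forall j, exists K, 1 <= K /\
    forall N (a b : 'I_N -> R), sign_mean (fun e => sign_norm a b e `^ r j) <=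
    K * Num.sqrt (\sum_i (a i ^+ 2 + b i ^+ 2)) `^ r j.
  move=> j; have [K K1 hK] := khintchine_upper (le_trans (ler0n R 2) (r_ge2 j)).
  by exists K.
have K0 j : 0 <= K j by apply: le_trans (hK j).1.
have L0 : 0 <= L by exact: le_trans L1.
exists (\prod_j (L * (1 + K j))).
  by apply: prodr_ge0 => j _; rewrite mulr_ge0// addr_ge0.
move=> k dX X mu dY Y nu T B B0 linT hyp g Gg.
have /choice[N hN] := fun j => square_hull_padding (Gg j).
(* a common length, so that the signs range over the same type for all j *)
pose M := \max_j N j.
have /choice[c hc] : forall j, exists c : 'I_M -> R, 
    exists f : 'I_M -> Y j -> scalar_field R k,
    [/\ forall i, 0 <= c i, \sum_i c i = 1,
        forall i, simple_space (nu j) (r j) (f i) /\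
                  (power_integral (nu j) (r j) (f i) <= 1)%E
      & g j = fun x => \sum_i c i * modulus (T j (f i) x) ^+ 2].
  by move=> j; apply: hN; exact: leq_bigmax.
have {hc} [f hf] : exists f : forall j, 'I_M -> Y j -> scalar_field R k, forall j,
    [/\ forall i, 0 <= c j i, \sum_i c j i = 1,
        forall i, simple_space (nu j) (r j) (f j i) /\
                  (power_integral (nu j) (r j) (f j i) <= 1)%E
      & g j = fun x => \sum_i c j i * modulus (T j (f j i) x) ^+ 2].
  by exists (fun j => projT1 (cid (hc j))) => j; exact: projT2 (cid (hc j)).
pose Sg := {ffun 'I_M -> bool}.
pose F j (e : Sg) : Y j -> scalar_field R k := fun y => signed_sum (c j) (fun i => f j i y) e.
have SF j e : simple_space (nu j) (r j) (F j e).
  by apply: simple_space_sum => // i; have [_ _ h _] := hf j; exact: (h i).1.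
pose n j e := fine (scalar_Lnorm (nu j) (r j) (F j e)).
have nE j e : scalar_Lnorm (nu j) (r j) (F j e) = (n j e)%:E.
  by rewrite fineK// ge0_fin_numE ?scalar_Lnorm_ge0//; have [] := SF j e.
have n0 j e : 0 <= n j e by rewrite fine_ge0// scalar_Lnorm_ge0.
have meann j : sign_mean (fun e => n j e `^ (2 * theta j)) <= 1 + K j.
  have [c0 c1 Sf _] := hf j.
  have := mean_power_integral_signed_sum (r_ge2 j) (hK j).2 (K0 j) c0 c1
    (fun i => (Sf i).1) (fun i => (Sf i).2).
  have -> : (fun e => fine (power_integral (nu j) (r j)
      (fun y => signed_sum (c j) ((f j)^~ y) e))) = (fun e => n j e `^ r j).
    by apply/funext => e; rewrite -(scalar_Lnorm_powR _ (r_ge2 j)) -/(F j e) nE.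
  (* n^(2 theta) <= 1 + n^r, because 2 theta <= 2 <= r *)
  move=> meanr; apply: (@le_trans _ _ (sign_mean (fun e => 1 + n j e `^ r j))).
    apply: sign_mean_le => e; have [le1|gt1] := leP (n j e) 1.
      apply: (@le_trans _ _ 1); last by rewrite lerDl powR_ge0.
      rewrite -[leRHS](_ : 1 `^ (2 * theta j) = 1); last by rewrite powR1.
      by apply: ge0_ler_powR; rewrite ?nnegrE// mulr_ge0// ltW.
    apply: (@le_trans _ _ (n j e `^ r j)); last by rewrite lerDr.
    apply: ler_powR; first exact: ltW.
    by apply: le_trans (r_ge2 j); rewrite ger_pMr// (theta_le1 theta_gt0 theta_sum).
  by rewrite sign_meanD sign_mean_cst lerD2l.
pose Tn j e x := modulus (T j (F j e) x) `^ (2 * theta j).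
have mTn j e : measurable_fun setT (Tn j e).
  by apply: measurable_powR_modulus; exact: (linT j).1.
pose kap := \prod_(j : J) (L * (2 ^+ M)^-1).
have kap0 : 0 <= kap.
  by apply: prodr_ge0 => j _; rewrite mulr_ge0 ?invr_ge0 ?exprn_ge0.
have expand (u : J -> Sg -> R) :
    \prod_j (L * sign_mean (u j)) = kap * \sum_(E : {ffun J -> Sg}) \prod_j u j (E j).
  rewrite -bigA_distr_bigA -big_split/=; apply: eq_bigr => j _.
  by rewrite /sign_mean mulrA.
pose Phi x := kap * \sum_(E : {ffun J -> Sg}) \prod_j Tn j (E j) x.
have pointwise : {ae mu, forall x, setT x ->
    ((\prod_j g j x `^ theta j)%:E <= (Phi x)%:E)%E}.
  have aeF : {ae mu, forall x j (e : Sg), T j (F j e) x =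
      signed_sum (c j) (fun i => T j (f j i) x) e}.
    apply: filter_forall => j; apply: filter_forall => e.
    by apply: linear_operator_sum (r_ge2 j) (linT j) _ _ _ _ _ => i; have [_ _ h _] := hf j; exact: (h i).1.
  apply: filterS aeF => x TF _; rewrite lee_fin /Phi -(expand (fun j e => Tn j e x)).
  apply: ler_prod => j _; rewrite powR_ge0/=.
  have [c0 c1 _ ->] := hf j.
  have th01 : 0 < theta j <= 1 by rewrite theta_gt0 (theta_le1 theta_gt0 theta_sum).
  have := @signed_sum_lower R k L (theta j) M (c j) (fun i => T j (f j i) x) hL th01 c0.
  move=> /le_trans; apply; rewrite ler_wpM2l//; apply: sign_mean_le => e.
  by rewrite /Tn TF.
have prodTn0 (E : {ffun J -> Sg}) x : 0 <= \prod_j Tn j (E j) x.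
  by apply: prodr_ge0 => j _; exact: powR_ge0.
have mprodTn (E : {ffun J -> Sg}) : measurable_fun setT (fun x => \prod_j Tn j (E j) x).
  exact: measurable_prod.
have mPhi : measurable_fun setT Phi by apply: measurable_funM => //; exact: measurable_sum.
have mg : measurable_fun setT (fun x => \prod_j g j x `^ theta j).
  by apply: measurable_geomean => j; exact: measurable_square_hull (linT j) _ (Gg j).
apply: (@le_trans _ _ (\int[mu]_x (Phi x)%:E)%E).
  apply: ae_ge0_le_integral => //.
  - by move=> x _; rewrite lee_fin prod_powR_ge0.
  - exact/measurable_EFinP.
  - by move=> x _; rewrite lee_fin mulr_ge0// sumr_ge0.
  - exact/measurable_EFinP.
rewrite integralRZ//; last 2 first.
  by move=> x; apply: sumr_ge0.
  exact: measurable_sum.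
rewrite integralR_sum//.
apply: (@le_trans _ _ (kap%:E * (B * \sum_(E : {ffun J -> Sg})
    \prod_j n j (E j) `^ (2 * theta j))%:E)%E).
  apply: lee_wpmul2l; rewrite ?lee_fin// mulr_sumr -sumEFin; apply: lee_sum => E _.
  have := hyp (fun j => F j (E j)) (fun j => SF j (E j)).
  have -> : (\prod_j scalar_Lnorm (nu j) (r j) (F j (E j)) `^ (2 * theta j) =
      (\prod_j n j (E j) `^ (2 * theta j))%:E)%E.
    by rewrite -prodEFin; apply: eq_bigr => j _; rewrite nE poweR_EFin.
  by rewrite -EFinM.
rewrite -EFinM lee_fin mulrCA -(expand (fun j e => n j e `^ (2 * theta j))) mulrC ler_wpM2r//.
apply: ler_prod => j _; rewrite mulr_ge0//=; last first.
  by rewrite mulr_ge0 ?invr_ge0 ?exprn_ge0// sumr_ge0// => e _; exact: powR_ge0.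
by rewrite ler_wpM2l.
Qed.

End vector_valued.

(** * The factorisation theorem *)

(** Saturation by the T j is used for one j after the other, on smaller and
    smaller sets. *)
Lemma square_hull_saturating (R : realType) (k : scalar_kind) (J : finType)
    dX (X : measurableType dX) (mu : {measure set X -> \bar R})
    (dY : J -> measure_display) (Y : forall j, measurableType (dY j))
    (nu : forall j, {measure set (Y j) -> \bar R}) (r : J -> R)
    (T : forall j, (Y j -> scalar_field R k) -> (X -> scalar_field R k)) :
  (forall j, 2 <= r j) ->
  (forall j, linear_operator mu (simple_space (nu j) (r j)) (T j)) ->
  (forall j, saturates mu (simple_space (nu j) (r j)) (T j)) ->
  forall E : set X, measurable E -> (0 < mu E)%E ->
  exists E' : set X, [/\ measurable E', E' `<=` E, (0 < mu E')%E &
    exists2 S : J -> X -> R, forall j, square_hull (nu j) (r j) (T j) (S j) &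
      {ae mu, forall x, E' x -> forall j, 0 < S j x}].
Proof.
move=> r2 linT satT E mE E0.
suff : forall s : seq J, exists E' : set X, [/\ measurable E', E' `<=` E, (0 < mu E')%E &
    forall j, j \in s -> exists2 S, square_hull (nu j) (r j) (T j) S &
      {ae mu, forall x, E' x -> 0 < S x}].
  move=> /(_ (enum J)) [E' [mE' E'E E'0 hE']]; exists E'; split => //.
  have /choice[S hS] : forall j, exists S, square_hull (nu j) (r j) (T j) S /\
      {ae mu, forall x, E' x -> 0 < S x}.
    by move=> j; have [|S ? ?] := hE' j; [rewrite mem_enum|exists S].
  exists S; first by move=> j; exact: (hS j).1.
  have : {ae mu, forall x j, E' x -> 0 < S j x}.
    by apply: filter_forall => j; exact: (hS j).2.
  by apply: filterS => x h E'x j; exact: h.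
elim=> [|j0 s [E1 [mE1 E1E E10 hE1]]]; first by exists E; split.
have [E' [mE' E'E1 E'0 [h Sh hpos]]] := satT j0 E1 mE1 E10.
exists E'; split => //; first exact: subset_trans E'E1 E1E.
move=> j; rewrite inE => /orP[/eqP ->|js]; last first.
  have [S GS Spos] := hE1 j js; exists S => //.
  by apply: filterS Spos => x Sx E'x; exact/Sx/E'E1.
have hfin : scalar_Lnorm (nu j0) (r j0) h \is a fin_num.
  by rewrite ge0_fin_numE ?scalar_Lnorm_ge0//; have [] := Sh.
have n0 : 0 <= fine (scalar_Lnorm (nu j0) (r j0) h).
  by rewrite fine_ge0// scalar_Lnorm_ge0.
have [||g Gg hg] := square_hull_scaled (m := fine (scalar_Lnorm (nu j0) (r j0) h) + 1)
  (r2 j0) (linT j0) Sh.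
- by rewrite ltr_wpDl.
- by rewrite EFinD fineK// leeDl.
exists g => //; apply: filterS2 hg hpos => x gE Tpos E'x.
have : 0 < modulus (T j0 h x) ^+ 2 by rewrite exprn_gt0// Tpos.
by rewrite gE pmulr_rgt0// exprn_gt0// ltr_wpDl.
Qed.

Theorem theorem1p6 (R : realType) (d : nat) (theta r : 'I_d -> R)
    (theta_gt0 : forall j, 0 < theta j)
    (theta_sum : \sum_(j < d) theta j = 1)
    (r_ge2 : forall j, 2 <= r j) :
  exists C : R,
  forall (k : scalar_kind)
    (dX : measure_display) (X : measurableType dX)
    (mu : {sigma_finite_measure set X -> \bar R})
    (dY : 'I_d -> measure_display) (Y : forall j, measurableType (dY j))
    (nu : forall j, {measure set (Y j) -> \bar R})
    (T : forall j, (Y j -> scalar_field R k) -> (X -> scalar_field R k))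
    (B : R),
  (forall j, linear_operator mu (simple_space (nu j) (r j)) (T j)) ->
  (forall j, saturates mu (simple_space (nu j) (r j)) (T j)) ->
  (forall f : forall j, Y j -> scalar_field R k,
     (forall j, simple_space (nu j) (r j) (f j)) ->
     (\int[mu]_x (\prod_(j < d) modulus (T j (f j) x) `^ (2 * theta j))%:E
      <= B%:E * \prod_(j < d)
                  scalar_Lnorm (nu j) (r j) (f j) `^ (2 * theta j))%E) ->
  exists phi : 'I_d -> X -> R,
    [/\ forall j, measurable_fun setT (phi j),
        forall j x, 0 <= phi j x,
        {ae mu, forall x, 1 <= \prod_(j < d) phi j x `^ theta j}
      & forall j (f : Y j -> scalar_field R k), simple_space (nu j) (r j) f ->
          ((\int[mu]_x (modulus (T j f x) ^+ 2 * phi j x)%:E) `^ 2^-1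
           <= (C * Num.sqrt B)%:E * scalar_Lnorm (nu j) (r j) f)%E].
Proof.
have [Lam Lam0 hLam] := square_hull_bound theta_gt0 theta_sum r_ge2.
pose kap := \sum_j (16 + 8 / theta j).
have term0 j : 0 <= 16 + 8 / theta j by rewrite addr_ge0// divr_ge0// ltW.
have kap0 : 0 <= kap by apply: sumr_ge0 => j _.
exists (Num.sqrt (kap * Lam)).
move=> k dX X mu dY Y nu T B linT satT hyp.
(* B may be negative, in which case Num.sqrt B = 0 and the hypothesis with B'
   suffices *)
pose B' := Num.max 0 B.
have B'0 : 0 <= B' by rewrite le_max lexx.
have sqrtB : Num.sqrt B = Num.sqrt B'.
  by rewrite /B'; case: (leP 0 B) => // B0; rewrite sqrtr0 ler0_sqrtr// ltW.
have hyp' (f : forall j, Y j -> scalar_field R k) :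
    (forall j, simple_space (nu j) (r j) (f j)) ->
    (\int[mu]_x (\prod_j modulus (T j (f j) x) `^ (2 * theta j))%:E
     <= B'%:E * \prod_j scalar_Lnorm (nu j) (r j) (f j) `^ (2 * theta j))%E.
  move=> Sf; apply: le_trans (hyp f Sf) _; apply: lee_wpmul2r.
    by apply: prode_ge0 => j _; exact: poweR_ge0.
  by rewrite lee_fin le_max lexx orbT.
pose A := Lam * B'; have A0 : 0 <= A by exact: mulr_ge0.
have scaled j (f : Y j -> scalar_field R k) (m : R) : simple_space (nu j) (r j) f ->
    fine (scalar_Lnorm (nu j) (r j) f) < m ->
    exists2 g, square_hull (nu j) (r j) (T j) g &
      {ae mu, forall x, modulus (T j f x) ^+ 2 = m ^+ 2 * g x}.
  move=> Sf fm; have ffin : scalar_Lnorm (nu j) (r j) f \is a fin_num.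
    by rewrite ge0_fin_numE ?scalar_Lnorm_ge0//; have [] := Sf.
  apply: (square_hull_scaled (r_ge2 j) (linT j) Sf).
    by apply: le_lt_trans fm; rewrite fine_ge0// scalar_Lnorm_ge0.
  by rewrite -[leLHS]fineK// lee_fin ltW.
have [phi [mphi phi0 phi_prod phi_int]] := @disentanglement _ X R mu _ theta
  (fun j => square_hull (nu j) (r j) (T j)) A theta_gt0 theta_sum
  (fun j g => @measurable_square_hull R k _ X mu _ (Y j) (nu j) (r j) (T j) (linT j) g)
  (fun j g => @square_hull_ge0 R k _ X _ (Y j) (nu j) (r j) (T j) g)
  (fun j g h t => @convex_square_hull R k _ X _ (Y j) (nu j) (r j) (T j) g h t) A0
  (hLam k dX X mu dY Y nu T B' B'0 linT hyp')
  (fun j => let: ex_intro2 g Gg _ := scaled j _ _ (simple_space0 k (nu j) (r_ge2 j))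
     (ltr_pwDr ltr01 (lexx _)) in ex_intro _ g Gg)
  (square_hull_saturating r_ge2 linT satT).
exists phi; split => // j f Sf.
have ffin : scalar_Lnorm (nu j) (r j) f \is a fin_num.
  by rewrite ge0_fin_numE ?scalar_Lnorm_ge0//; have [] := Sf.
set n := fine (scalar_Lnorm (nu j) (r j) f).
have n0 : 0 <= n by rewrite fine_ge0// scalar_Lnorm_ge0.
set I := (\int[mu]_x _)%E.
have I0 : (0 <= I)%E.
  by apply: integral_ge0 => x _; rewrite lee_fin mulr_ge0 ?sqr_ge0.
(* f / m lies in the unit ball for every m greater than the norm n of f *)
have I_le m : n < m -> (I <= (m ^+ 2 * (kap * A))%:E)%E.
  move=> nm; have [g Gg gE] := scaled j f m Sf nm.
  have mg := measurable_square_hull (linT j) Gg; have g0 := square_hull_ge0 Gg.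
  have -> : I = (\int[mu]_x (m ^+ 2 * (g x * phi j x))%:E)%E.
    apply: ge0_ae_eq_integral => //.
    - apply/measurable_EFinP; apply: measurable_funM => //.
      by apply: measurable_funX; apply: measurable_modulus; exact: (linT j).1.
    - by apply/measurable_EFinP; apply: measurable_funM => //; exact: measurable_funM.
    - by move=> x _; rewrite lee_fin mulr_ge0 ?sqr_ge0.
    - by move=> x _; rewrite lee_fin mulr_ge0 ?sqr_ge0// mulr_ge0.
    - by apply: filterS gE => x gx _; rewrite gx mulrA.
  rewrite integralRZ ?sqr_ge0//; last 2 first.
    by move=> x; rewrite mulr_ge0.
    exact: measurable_funM.
  rewrite [leRHS]EFinM; apply: lee_wpmul2l; first by rewrite lee_fin sqr_ge0.
  apply: le_trans (phi_int j g Gg) _; rewrite lee_fin ler_wpM2r//.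
  by rewrite /kap (bigD1 j)//= lerDl; apply: sumr_ge0 => i _.
have Ifin : I \is a fin_num.
  by rewrite ge0_fin_numE// (le_lt_trans (I_le (n + 1) _)) ?ltry// ltrDl.
rewrite -(fineK Ifin) -(fineK ffin) -/n poweR_EFin powR12_sqrt ?fine_ge0//.
rewrite -EFinM lee_fin sqrtB -sqrtrM ?mulr_ge0// -mulrA -/A.
set s := Num.sqrt (kap * A); have s0 : 0 <= s by exact: sqrtr_ge0.
apply/ler_addgt0Pr => e e0.
have s1 : 0 < s + 1 by rewrite ltr_wpDl.
have es : 0 < e / (s + 1) by exact: divr_gt0.
apply: (@le_trans _ _ ((n + e / (s + 1)) * s)).
  have m0 : 0 <= n + e / (s + 1) by rewrite addr_ge0// ltW.
  rewrite -[X in _ <= X * s]ger0_norm// -sqrtr_sqr -sqrtrM ?sqr_ge0// ler_wsqrtr//.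
  by rewrite -lee_fin fineK// I_le// ltrDl.
rewrite mulrDl [s * n]mulrC lerD2l mulrAC ler_pdivrMr// ler_wpM2l ?(ltW e0)//.
by rewrite lerDl.
Qed.
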